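(* Let $\lambda=(\lambda_1\ge\dots\ge\lambda_n)$ be a partition and $w_0\in S_n$ the longest permutation. Then the Grassmannian Grothendieck polynomial $G_\lambda^{(\beta)}=\mathscr{L}_{w_0,\lambda}$ satisfies \[ G_{\lambda}^{(\beta)} = \mathscr{L}_{w_0, \lambda} = \sum_{P \in \mathscr{P}^+(\lambda)} x^P . \]
   Context: Divided difference operators on $\mathbb{Z}[\beta][x_1,\dots,x_n]$: $\partial_i f=(f-s_if)/(x_i-x_{i+1})$, where $s_if$ swaps $x_i,x_{i+1}$. Demazure--Lascoux operators: $\pi_i^{(\beta)}(f)=\partial_i(x_if+\beta x_ix_{i+1}f)$, $1\le i\le n-1$; they satisfy the braid relations. For $w\in S_n$ with reduced word $w=s_{i_1}\cdots s_{i_k}$, the Lascoux polynomial is $\mathscr{L}_{w,\lambda}=\pi^{(\beta)}_{i_k}\cdots\pi^{(\beta)}_{i_2}\pi^{(\beta)}_{i_1}(x^\lambda)$, $x^\lambda=x_1^{\lambda_1}\cdots x_n^{\lambda_n}$; $\mathscr{L}_{w_0,\lambda}$ is the Grassmannian Grothendieck polynomial $G_\lambda^{(\beta)}$. A Gelfand--Zetlin (GZ) pattern with top row $\lambda$ is a triangular array of integers $a_{ij}$, $0\le i\le n-1$, $1\le j\le n-i$, with $a_{0j}=\lambda_{n+1-j}$ and $a_{i-1,j}\le a_{ij}\le a_{i-1,j+1}$ for $i\ge1$; rows are numbered from the top, and $a_{ij}$ ($i\ge1$) sits below its upper neighbours $a_{i-1,j}$ and $a_{i-1,j+1}$. An enhanced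 GZ pattern is a GZ pattern with top row $\lambda$ together with a set of ''encircled'' entries and a set of edges, each joining an entry $a_{ij}$ ($i\ge1$) with $a_{i-1,j}$ or $a_{i-1,j+1}$, such that: (1) all entries of row $0$ are encircled; (2) entries joined by an edge are equal and the lower one is encircled; (3) for $i\ge1$, $1\le j\le n-i-1$, both $a_{ij},a_{i,j+1}$ are joined by edges to $a_{i-1,j+1}$ iff both are joined by edges to $a_{i+1,j}$; (4) if $a_{0j}=a_{0,j+1}$ then $a_{1j}$ is encircled and joined to both; (5) if $a_{i-1,j}<a_{i-1,j+1}$ and $a_{ij}=a_{i-1,j}$ then $a_{ij}$ is encircled and joined to $a_{i-1,j}$; (6) if $a_{i-1,j}<a_{i-1,j+1}$, $a_{ij}=a_{i-1,j+1}$ and $a_{ij}$ is encircled, then $a_{ij}$ is joined to $a_{i-1,j+1}$; (7) if $a_{i-1,j}=a_{i-1,j+1}=a_{ij}$ and $a_{i-1,j},a_{i-1,j+1}$ can be connected by a path of edges, then $a_{ij}$ is encircled and joined to both; (8) if $a_{i-1,j}=a_{i-1,j+1}=a_{ij}$ and $a_{ij}$ is encircled, then it is joined to at least one of them. The rank $\mathrm{rk}\,P$ is the number of non-encircled entries. $P$ is inefficient if it contains $a_{i-1,j}=a_{i-1,j+1}=a_{ij}$ with no edge between $a_{ij}$ and $a_{i-1,j+1}$, and efficient otherwise; $\mathscr{P}^+(\lambda)$ is the set of efficient enhanced patterns with top row $\lambda$. For efficient $P$: let $S_i(P)$ be the sum of entries of row $i$ ($S_0=\lambda_1+\dots+\lambda_n$,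 and $S_n=0$), $D_i(P)$ the number of non-encircled entries of row $i$ ($D_n=0$), $d_{n+1-i}=S_{i-1}(P)-S_i(P)+D_i(P)$ for $1\le i\le n$, and $x^P=\beta^{\mathrm{rk} P}x_1^{d_1}\cdots x_n^{d_n}$. *)

(* Defs.v *)
From HB Require Import structures.
From mathcomp Require Import all_boot all_order all_algebra all_fingroup.
From mathcomp Require Import mpoly.
From Stdlib Require Import ClassicalEpsilon ClassicalDescription.

Set Implicit Arguments.
Unset Strict Implicit.
Unset Printing Implicit Defensive.

Import Order.TTheory GRing.Theory Num.Theory.
Local Open Scope ring_scope.

(* Coefficient ring Z[beta] = {poly int}; the polynomial ring Z[beta][x_1..x_n]. *)
Definition PR (n : nat) := {mpoly {poly int}[n]}.

Definition beta (n : nat) : PR n := ('X : {poly int})%:MP.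

(* Variables are 0-based: x_(k+1) of the paper is 'X_k, k : 'I_n. *)

Definition swapv n (a b : 'I_n) (f : PR n) : PR n := msym (tperm a b) f.

(* Divided difference: the (unique, since PR n is a domain) g with
   (x_a - x_b) g = f - s f.  Defined by choice; it exists for every f. *)
Definition divdiff n (a b : 'I_n) (f : PR n) : PR n :=
  epsilon (inhabits 0)
    (fun g : PR n => ('X_a - 'X_b) * g = f - swapv a b f).

(* Demazure--Lascoux operator pi_i, for the paper's i = (i0+1), i.e. acting on
   the variables x_(i0+1) = 'X_i0 and x_(i0+2) = 'X_(i0+1); requires i0+1 < n
   (identity otherwise, never used). *)
Definition pi_op n (i0 : nat) (f : PR n) : PR n :=
  match insub i0 : option 'I_n, insub i0.+1 : option 'I_n with
  | Some a, Some b => divdiff a b ('X_a * f + beta n * 'X_a * 'X_b * f)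
  | _, _ => f
  end.

Definition stp n (i0 : nat) : 'S_n :=
  match insub i0 : option 'I_n, insub i0.+1 : option 'I_n with
  | Some a, Some b => tperm a b
  | _, _ => 1%g
  end.

Definition perm_length n (w : 'S_n) : nat :=
  #|[set p : 'I_n * 'I_n | (p.1 < p.2)%N && (w p.2 < w p.1)%N]|.

Definition w0 n : 'S_n := perm (@rev_ord_inj n).

Definition reduced_word n (w : 'S_n) (s : seq nat) : Prop :=
  all (fun i => i.+1 < n)%N s /\
  (\prod_(i <- s) stp n i)%g = w /\ size s = perm_length w.

Definition lascoux_word n (s : seq nat) (lam : n.-tuple nat) : PR n :=
  foldl (fun f i => pi_op i f) (\prod_(k < n) 'X_k ^+ (tnth lam k)) s.

(* Enhanced Gelfand--Zetlin patterns.
   Positions (i, j) are 0-based in both coordinates: row i (0 <= i < n) has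
   entries j = 0 .. n-i-1; the paper's a_{i,j} is our entry (i, j-1).
   Entries are bounded by M (any M >= lambda_1 works, since interlacing forces
   all entries into [lambda_n, lambda_1]).
   A pattern is (a, C, EL, ER): a = entries, C = encircled entries,
   (i,j) \in EL  <=>  edge between (i,j) and its upper-left neighbour (i-1,j),
   (i,j) \in ER  <=>  edge between (i,j) and its upper-right neighbour (i-1,j+1). *)
Definition patT (n M : nat) : finType :=
  ({ffun 'I_n * 'I_n -> 'I_M.+1} * {set 'I_n * 'I_n} * {set 'I_n * 'I_n}
    * {set 'I_n * 'I_n})%type.

Section Pattern.
Variables (n M : nat) (P : patT n M).

Definition pA := P.1.1.1.
Definition pC := P.1.1.2.
Definition pEL := P.1.2.
Definition pER := P.2.

Definition validpos (i j : nat) : bool := (i < n)%N && (j < n - i)%N.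

Definition lookup (T : Type) (d : T) (F : 'I_n * 'I_n -> T) (i j : nat) : T :=
  match insub i : option 'I_n, insub j : option 'I_n with
  | Some a, Some b => F (a, b)
  | _, _ => d
  end.

Definition ent (i j : nat) : nat := lookup 0%N (fun p => val (pA p)) i j.
Definition circ (i j : nat) : bool := lookup false (fun p => p \in pC) i j.
Definition eL (i j : nat) : bool := lookup false (fun p => p \in pEL) i j.
Definition eR (i j : nat) : bool := lookup false (fun p => p \in pER) i j.

Definition canonical : bool :=
  [forall p : 'I_n * 'I_n,
    ~~ validpos p.1 p.2 ==> [&& val (pA p) == 0%N, p \notin pC,
                               p \notin pEL & p \notin pER]] &&
  [forall p : 'I_n * 'I_n,
    (val p.1 == 0%N) ==> (p \notin pEL) && (p \notin pER)].

Definition adj (p q : 'I_n * 'I_n) : bool :=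
  let edge u v := ((u \in pEL) && (val v.1 == (val u.1).-1) && (val v.2 == val u.2))
               || ((u \in pER) && (val v.1 == (val u.1).-1) && (val v.2 == (val u.2).+1)) in
  edge p q || edge q p.

Definition connected (i j i' j' : nat) : bool :=
  match insub i : option 'I_n, insub j : option 'I_n,
        insub i' : option 'I_n, insub j' : option 'I_n with
  | Some a, Some b, Some c, Some d => connect adj (a, b) (c, d)
  | _, _, _, _ => false
  end.

Definition enhancedGZ (lam : n.-tuple nat) : Prop :=
  canonical /\
  (* GZ pattern with top row lambda: a_{0,j} = lambda_{n+1-j} *)
  (forall j, (j < n)%N -> ent 0 j = nth 0%N lam (n.-1 - j)) /\
  (forall i j, (1 <= i)%N -> validpos i j ->
     (ent i.-1 j <= ent i j <= ent i.-1 j.+1)%N) /\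
  (forall j, (j < n)%N -> circ 0 j) /\
  (forall i j, validpos i j -> eL i j -> ent i j = ent i.-1 j /\ circ i j) /\
  (forall i j, validpos i j -> eR i j -> ent i j = ent i.-1 j.+1 /\ circ i j) /\
  (forall i j, (1 <= i)%N -> validpos i j.+1 ->
     (eR i j && eL i j.+1) = (eL i.+1 j && eR i.+1 j)) /\
  (forall j, (j.+1 < n)%N -> ent 0 j = ent 0 j.+1 ->
     [&& circ 1 j, eL 1 j & eR 1 j]) /\
  (forall i j, (1 <= i)%N -> validpos i j ->
     (ent i.-1 j < ent i.-1 j.+1)%N -> ent i j = ent i.-1 j ->
     circ i j && eL i j) /\
  (forall i j, (1 <= i)%N -> validpos i j ->
     (ent i.-1 j < ent i.-1 j.+1)%N -> ent i j = ent i.-1 j.+1 ->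
     circ i j -> eR i j) /\
  (forall i j, (1 <= i)%N -> validpos i j ->
     ent i.-1 j = ent i.-1 j.+1 -> ent i j = ent i.-1 j ->
     connected i.-1 j i.-1 j.+1 -> [&& circ i j, eL i j & eR i j]) /\
  (forall i j, (1 <= i)%N -> validpos i j ->
     ent i.-1 j = ent i.-1 j.+1 -> ent i j = ent i.-1 j ->
     circ i j -> eL i j || eR i j).

Definition inefficient : Prop :=
  exists i j, [/\ (1 <= i)%N, validpos i j,
     ent i.-1 j = ent i.-1 j.+1, ent i j = ent i.-1 j & ~~ eR i j].

Definition efficient : Prop := ~ inefficient.

Definition rank : nat :=
  #|[set p : 'I_n * 'I_n | validpos p.1 p.2 && (p \notin pC)]|.

Definition rowS (i : nat) : nat := \sum_(j < n | validpos i j) ent i j.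
Definition rowD (i : nat) : nat :=
  #|[set j : 'I_n | validpos i j && ~~ circ i j]|.

(* d_{n+1-i} = S_{i-1} - S_i + D_i ; with 0-based variable k = n-i, i = n-k *)
Definition dexp (k : nat) : nat :=
  (rowS (n - k).-1 + rowD (n - k) - rowS (n - k))%N.

Definition xP : PR n :=
  beta n ^+ rank * \prod_(k < n) 'X_k ^+ dexp k.

End Pattern.

Definition lmax (s : seq nat) : nat := foldr maxn 0%N s.

Definition propb (Q : Prop) : bool :=
  if excluded_middle_informative Q then true else false.

Definition effpat n (lam : n.-tuple nat) (P : patT n (lmax lam)) : bool :=
  propb (enhancedGZ P lam /\ efficient P).

(* Main.v *)
Require Import Defs.
From HB Require Import structures.
From mathcomp Require Import all_boot all_order all_algebra all_fingroup.
From mathcomp Require Import mpoly zify ring.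
From Stdlib Require Import ClassicalEpsilon ClassicalDescription.

(** Both sides equal the ratio of alternants
    [det (x_i^(al_j + j) (1 + b x_i)^(n-1-j)) / prod_(j < i) (x_i - x_j)], where
    [al] is [lam] in increasing order.

    Operator side.  The operators [pi_i] satisfy the braid relations, so by
    Matsumoto's theorem a reduced word of [w0] may be assumed to end in any
    letter, and its value is a symmetric polynomial.  The antisymmetrizer [A]
    satisfies [A (Phi * pi_i f) = A (Phi * f)] for
    [Phi = prod_k x_k^(n-1-k) (1 + b x_k)^k]; hence the value [L] of a reduced
    word of [w0] on [x^lam] satisfies [L * A Phi = A (Phi * x^lam)].

    Pattern side.  In an efficient pattern the edges are determined by the
    entries and the circles, an entry must be encircled exactly when it equals
    its upper-left neighbour, and all other circles are free.  Summing over the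
    circles leaves a sum over Gelfand-Zetlin patterns in which an entry larger
    than its upper-left neighbour contributes a factor [1 + b x].  Peeling off
    the top row gives a recursion, which the alternant satisfies as well by row
    operations that clear its last column. *)

Set Implicit Arguments.
Unset Strict Implicit.
Unset Printing Implicit Defensive.
Import Order.TTheory GRing.Theory Num.Theory.
Local Open Scope ring_scope.

(** * Reduced words *)

Section Length.
Variable n : nat.
Implicit Types (w u : 'S_n) (a b c : 'I_n) (r s : seq nat).

Definition invset w := [set p : 'I_n * 'I_n | (p.1 < p.2)%N && (w p.2 < w p.1)%N].

Lemma stpE a b : b = a.+1 :> nat -> stp n a = tperm a b.
Proof.
by move=> ab; rewrite /stp (valK a) -ab (valK b).
Qed.

Lemma tperm_adj_lt a b (i j : 'I_n) : b = a.+1 :> nat -> (i < j)%N ->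
  (tperm a b i < tperm a b j)%N = ((i, j) != (a, b)).
Proof.
move=> ab + ; rewrite xpair_eqE -!val_eqE /=.
case: tpermP => [->|->|/eqP + /eqP]; case: tpermP => [->|->|/eqP + /eqP];
  rewrite -?val_eqE /= ?ab; lia.
Qed.

(** Products act left factor first, so [tperm a b * w] exchanges the values of [w] at two adjacent
    positions. Applying [t] to both positions carries the inversions of [t * w] other than [(a, b)]
    onto the inversions of [w]. *)
Lemma length_mulL_lt w a b : b = a.+1 :> nat -> (w a < w b)%N ->
  perm_length (tperm a b * w) = (perm_length w).+1.
Proof.
move=> ab wab; set t := tperm a b.
pose tau (p : 'I_n * 'I_n) := (t p.1, t p.2).
have tauI : injective tau.
  by move=> [x1 x2] [y1 y2] [] /perm_inj -> /perm_inj ->.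
rewrite /perm_length -/(invset _) -/(invset w) (cardsD1 (a, b)).
have -> : (a, b) \in invset (t * w) by rewrite inE /= !permM tpermL tpermR wab ab ltnSn.
rewrite add1n; congr S; rewrite -[RHS](card_preimset _ tauI); apply: eq_card => -[x y].
rewrite !inE /= !permM.
case: (ltngtP x y) => [lxy|lyx|/val_inj ->].
- by rewrite tperm_adj_lt.
- rewrite andbF; case: (boolP ((y, x) == (a, b))) => [/eqP [-> ->]|nyx].
    by rewrite tpermL tpermR ab ltnSn /= ltnNge ltnW.
  by rewrite ltnNge ltnW // tperm_adj_lt.
- by rewrite !ltnn /= andbF.
Qed.

Lemma length_mulL_gt w a b : b = a.+1 :> nat -> (w b < w a)%N ->
  perm_length w = (perm_length (tperm a b * w)).+1.
Proof.
move=> ab wab; rewrite -(@length_mulL_lt (tperm a b * w) a b) //.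
  by rewrite mulgA tperm2 mul1g.
by rewrite !permM tpermL tpermR.
Qed.

Lemma adj_dich w a b : b = a.+1 :> nat -> (w a < w b)%N \/ (w b < w a)%N.
Proof.
move=> ab; case: (ltngtP (w a) (w b)) => [|| /val_inj/perm_inj e]; [by left|by right|].
by move: ab; rewrite e; lia.
Qed.

Lemma adj_in (i : nat) : (i.+1 < n)%N -> exists a b, val a = i /\ b = i.+1 :> nat.
Proof. by move=> h; exists (Ordinal (ltnW h)), (Ordinal h). Qed.

Lemma length_prod_le r : all (fun i => i.+1 < n)%N r ->
  (perm_length (\prod_(i <- r) stp n i)%g <= size r)%N.
Proof.
elim: r => [_|i r IH /= /andP [hi /IH hr]].
  rewrite big_nil leqn0 cards_eq0; apply/eqP/setP => -[x y].
  by rewrite !inE /= !perm1; lia.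
have [a [b [ea eb]]] := adj_in hi.
rewrite big_cons -ea (@stpE a b) ?eb ?ea //.
have ab : b = a.+1 :> nat by rewrite ea.
have [h|h] := adj_dich (\prod_(i <- r) stp n i)%g ab.
  by rewrite length_mulL_lt.
by apply/leqW/ltnW; rewrite -length_mulL_gt.
Qed.

(** Strict growth at each step gives [w a + k <= w (a + k)]. Started at position 0 this bounds [w x]
    below by [x]; run up to the last position it bounds [w x] above by [x]. *)
Lemma perm_no_descent w :
  (forall a b, b = a.+1 :> nat -> (w a < w b)%N) -> w = 1%g.
Proof.
move=> mono.
have lew (k : nat) a b : b = (a + k)%N :> nat -> (w a + k <= w b)%N.
  elim: k b => [|k IH] b eb; first by rewrite addn0 (_ : a = b) //; apply/val_inj; rewrite /= eb addn0.
  have hk : (a + k < n)%N by have := ltn_ord b; rewrite eb; lia.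
  have := IH (Ordinal hk) erefl; have /mono : b = (Ordinal hk).+1 :> nat by rewrite eb addnS.
  lia.
apply/permP => x; rewrite perm1; apply/val_inj; apply/eqP.
have n0 : (0 < n)%N by apply: leq_ltn_trans (ltn_ord x).
have h0 := lew x (Ordinal n0) x erefl.
have hm : (n.-1 < n)%N by lia.
have := lew (n.-1 - x)%N x (Ordinal hm).
have hx := ltn_ord x; have hw := ltn_ord (w (Ordinal hm)).
rewrite /= => h1; rewrite eqn_leq; apply/andP; split; lia.
Qed.

Lemma reduced_exists w : exists r, reduced_word w r.
Proof.
have [k] := ubnP (perm_length w); elim: k w => // k IH w lk.
case: (pickP (fun p : 'I_n * 'I_n => (val p.2 == p.1.+1) && (w p.2 < w p.1)%N)).
  move=> [a b] /= /andP [/eqP ab h]; have hl := length_mulL_gt ab h.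
  have [|r [r1 [r2 r3]]] := IH (tperm a b * w)%g; first by rewrite -ltnS -hl.
  exists (nat_of_ord a :: r); split; first by rewrite /= r1 -ab ltn_ord.
  split; last by rewrite /= r3 hl.
  by rewrite big_cons r2 (stpE ab) mulgA tperm2 mul1g.
move=> nod; exists [::]; rewrite (@perm_no_descent w); last first.
  move=> a b ab; have [//|h] := adj_dich w ab.
  by have := nod (a, b); rewrite /= ab eqxx h.
split=> //; rewrite big_nil; split=> //; apply/esym/eqP; rewrite cards_eq0.
by apply/eqP/setP => -[x y]; rewrite !inE /= !perm1; lia.
Qed.

(** A first letter of a reduced word must be a descent: at an ascent [tperm a b * w] would be longer
    than [w], yet [r] spells it with one letter fewer than the length of [w]. *)
Lemma reduced_cons w a b r : b = a.+1 :> nat ->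
  reduced_word w (nat_of_ord a :: r) <-> (w b < w a)%N /\ reduced_word (tperm a b * w) r.
Proof.
move=> ab; split.
  case=> /= /andP [_ r1] [r2 r3].
  have r4 : (\prod_(i <- r) stp n i)%g = (tperm a b * w)%g.
    by rewrite -r2 big_cons (stpE ab) mulgA tperm2 mul1g.
  have le := length_prod_le r1; rewrite r4 in le.
  have [h|h] := adj_dich w ab; first by rewrite (length_mulL_lt ab h) in le; lia.
  by split=> //; split=> //; split=> //; have := length_mulL_gt ab h; lia.
case=> h [r1 [r2 r3]]; split; first by rewrite /= r1 -ab ltn_ord.
split; last by rewrite /= r3 -length_mulL_gt.
by rewrite big_cons r2 (stpE ab) mulgA tperm2 mul1g.
Qed.

Lemma tperm_comm (a b c d : 'I_n) : a != c -> a != d -> b != c -> b != d ->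
  (tperm c d * tperm a b = tperm a b * tperm c d)%g.
Proof.
move=> Nac Nad Nbc Nbd; apply/permP => x; rewrite !permM.
have [->|Nxa] := eqVneq x a; first by rewrite tpermL !(@tpermD _ c d) ?tpermL // 1?eq_sym.
have [->|Nxb] := eqVneq x b; first by rewrite tpermR !(@tpermD _ c d) ?tpermR // 1?eq_sym.
have [->|Nxc] := eqVneq x c; first by rewrite tpermL !(@tpermD _ a b) ?tpermL.
have [->|Nxd] := eqVneq x d; first by rewrite tpermR !(@tpermD _ a b) ?tpermR.
by rewrite !(@tpermD _ _ _ x) 1?eq_sym.
Qed.

Lemma tperm_braid (a b d : 'I_n) : a != b -> a != d -> b != d ->
  (tperm a b * tperm b d * tperm a b = tperm b d * tperm a b * tperm b d)%g.
Proof.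
move=> Nab Nad Nbd; apply/permP => x; rewrite !permM.
have [->|Nxa] := eqVneq x a.
  by rewrite tpermL tpermL tpermD // 1?eq_sym // (@tpermD _ b d a) 1?eq_sym // tpermL tpermL.
have [->|Nxb] := eqVneq x b.
  by rewrite tpermR (@tpermD _ b d a) 1?eq_sym // tpermL tpermL (@tpermD _ a b d) // tpermR.
have [->|Nxd] := eqVneq x d.
  by rewrite (@tpermD _ a b d) // !tpermR (@tpermD _ b d a) // 1?eq_sym.
by rewrite !(@tpermD _ _ _ x) 1?eq_sym.
Qed.

Section Matsumoto.
Variables (X : Type) (T : nat -> X -> X).
Hypothesis T_far : forall i j : nat, (i.+1 < j)%N -> (j.+1 < n)%N ->
  forall f, T i (T j f) = T j (T i f).
Hypothesis T_braid : forall i : nat, (i.+2 < n)%N ->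
  forall f, T i (T i.+1 (T i f)) = T i.+1 (T i (T i.+1 f)).

(** Induction on the length of the words. Distinct first letters are both descents of [w], so [w]
    has two further reduced words that start with the two sides of the commutation or braid relation
    and agree afterwards. Each given word shares its first letter with one of these, and the
    induction hypothesis compares the tails. *)
Lemma matsumoto w r s f : reduced_word w r -> reduced_word w s ->
  foldr T f r = foldr T f s.
Proof.
move=> hr hs; have [k] := ubnP (size r).
elim: k w r s hr hs => // k IH w [|i r] [|j s] hr hs lk //=.
- by move: hr hs => [_ [_ +]] [_ [_ +]] => <- /=.
- by move: hr hs => [_ [_ +]] [_ [_ +]] => <- /=.
wlog lij : i j r s hr hs lk / (i <= j)%N.
  move=> W; case/orP: (leq_total i j) => h; first exact: W.
  apply/esym; apply: (W) => //; move: hr hs lk => [_ [_ +]] [_ [_ +]].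
  by rewrite /= => -> <-.
have hi : (i.+1 < n)%N by case: hr => /= /andP [].
have hj : (j.+1 < n)%N by case: hs => /= /andP [].
have [a [b [ea eb]]] := adj_in hi; have [c [d [ec ed]]] := adj_in hj.
have ab : b = a.+1 :> nat by rewrite ea.
have cd : d = c.+1 :> nat by rewrite ec.
rewrite -ea -ec in hr hs *.
have [wba hr'] := (reduced_cons w r ab).1 hr.
have [wdc hs'] := (reduced_cons w s cd).1 hs.
have szr : size r = size s.
  by case: hr => _ [_ h1]; case: hs => _ [_ h2]; move: h1 h2 => /= <- [->].
have stepr q : reduced_word (tperm a b * w) q -> foldr T f r = foldr T f q.
  by move=> hq; apply: (IH _ _ _ hr' hq); rewrite /= in lk.
have steps q : reduced_word (tperm c d * w) q -> foldr T f s = foldr T f q.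
  by move=> hq; apply: (IH _ _ _ hs' hq); rewrite /= -szr in lk *.
have [e|ne] := eqVneq i j.
  have eac : a = c by apply: val_inj; rewrite /= ea ec.
  have ebd : b = d by apply: val_inj; rewrite /= eb ed e.
  by subst c d; rewrite (stepr s).
have [far|near] := ltnP i.+1 j.
  have Nac : a != c by rewrite -val_eqE /= ea ec.
  have Nad : a != d by rewrite -val_eqE /= ea ed; lia.
  have Nbc : b != c by rewrite -val_eqE /= eb ec; lia.
  have Nbd : b != d by rewrite -val_eqE /= eb ed; lia.
  have comm : (tperm c d * tperm a b = tperm a b * tperm c d)%g.
    exact: tperm_comm.
  have [q hq] := reduced_exists (tperm c d * (tperm a b * w)).
  rewrite (stepr (nat_of_ord c :: q)); last first.
    by apply/(reduced_cons _ _ cd); split=> //; rewrite !permM !tpermD.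
  rewrite (steps (nat_of_ord a :: q)) /=; last first.
    apply/(reduced_cons _ _ ab); split=> //.
      by rewrite !permM !tpermD // 1?eq_sym.
    by rewrite mulgA -comm -mulgA.
  by rewrite T_far ?ea ?ec.
have ej : j = i.+1 by lia.
have ebc : b = c by apply: val_inj; rewrite /= eb ec ej.
subst c; rewrite ej in ec ed hj.
have Nab : a != b by rewrite -val_eqE /= ea eb; lia.
have Nad : a != d by rewrite -val_eqE /= ea ed; lia.
have Nbd : b != d by rewrite -val_eqE /= eb ed; lia.
pose u := (tperm a b * (tperm b d * (tperm a b * w)))%g.
have eu : u = (tperm b d * (tperm a b * (tperm b d * w)))%g.
  by rewrite /u !mulgA tperm_braid.
have [q hq] := reduced_exists u.
(* Two consecutive descents make [w] decrease on the positions [a], [b], [d], so three letters can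
   be stripped along either side of the braid relation; [u] is what remains. *)
have wda : (w d < w a)%N by apply: ltn_trans wdc wba.
rewrite (stepr [:: nat_of_ord b, nat_of_ord a & q]); last first.
  apply/(reduced_cons _ _ cd); split.
    by rewrite !permM tpermR tpermD.
  apply/(reduced_cons _ _ ab); split=> //.
  by rewrite !permM tpermL (@tpermD _ b d a) 1?eq_sym // (@tpermD _ a b d) // tpermL.
rewrite (steps [:: nat_of_ord a, nat_of_ord b & q]) /=; last first.
  apply/(reduced_cons _ _ ab); split.
    by rewrite !permM tpermL tpermD // eq_sym.
  apply/(reduced_cons _ _ cd); split; last by rewrite -eu.
  by rewrite !permM tpermR (@tpermD _ a b d) // tpermR tpermD 1?eq_sym.
by rewrite eb -ea T_braid ?ea // -ed ltn_ord.
Qed.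
End Matsumoto.

(** Reversing a word inverts its product, and [w0] is an involution. The reversal is needed because
    [lascoux_word] folds from the left while [matsumoto] folds from the right. *)
Lemma reduced_w0_rev s : reduced_word (w0 n) s -> reduced_word (w0 n) (rev s).
Proof.
case=> s1 [s2 s3]; split; first by rewrite all_rev.
split; last by rewrite size_rev.
have stpV i : ((stp n i)^-1 = stp n i)%g.
  rewrite /stp; case: (insub i : option 'I_n) => [a|]; rewrite ?invg1 //.
  by case: (insub i.+1 : option 'I_n) => [b|]; rewrite ?invg1 ?tpermV.
have -> : (\prod_(i <- rev s) stp n i = (\prod_(i <- s) stp n i)^-1)%g.
  elim: (s) => [|x t IH]; first by rewrite !big_nil invg1.
  by rewrite rev_cons -cats1 big_cat big_seq1 big_cons IH invMg stpV.
rewrite s2; apply/eqP; rewrite eq_invg_mul; apply/eqP/permP => x.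
by rewrite permM !permE rev_ordK.
Qed.

Lemma w0_reduced_head (i : nat) : (i.+1 < n)%N ->
  exists r, reduced_word (w0 n) (i :: r).
Proof.
move=> hi; have [a [b [ea eb]]] := adj_in hi.
have ab : b = a.+1 :> nat by rewrite ea.
have [r hr] := reduced_exists (tperm a b * w0 n).
exists r; rewrite -ea; apply/(reduced_cons _ _ ab); split=> //.
by rewrite !permE /=; have := ltn_ord b; lia.
Qed.

End Length.

(** * Demazure-Lascoux operators *)

Section BraidAlgebra.
Variables (R : idomainType) (b : R).
Let phi (x y : R) := x * (1 + b * y).

(** The elements [f], [f1], [f2], [f12], [f21], [f121] stand for the six images of a polynomial
    under permutations of three variables, and can be arbitrary. The hypotheses define the
    successive quotients and their images, so the braid relation becomes an identity linear in these
    six elements. *)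
Lemma braid_identity (x y z : R) (f f1 f2 f12 f21 f121 g g2 g12 h h1 k : R)
    (g' g1' g21' h' h2' k' : R) :
  x != y -> y != z -> x != z ->
  (x - y) * g = phi x y * f - phi y x * f1 ->
  (x - z) * g2 = phi x z * f2 - phi z x * f21 ->
  (y - z) * g12 = phi y z * f12 - phi z y * f121 ->
  (y - z) * h = phi y z * g - phi z y * g2 ->
  (x - z) * h1 = phi x z * g - phi z x * g12 ->
  (x - y) * k = phi x y * h - phi y x * h1 ->
  (y - z) * g' = phi y z * f - phi z y * f2 ->
  (x - z) * g1' = phi x z * f1 - phi z x * f12 ->
  (x - y) * g21' = phi x y * f21 - phi y x * f121 ->
  (x - y) * h' = phi x y * g' - phi y x * g1' ->
  (x - z) * h2' = phi x z * g' - phi z x * g21' ->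
  (y - z) * k' = phi y z * h' - phi z y * h2' ->
  k = k'.
Proof.
rewrite -[x == y]subr_eq0 -[y == z]subr_eq0 -[x == z]subr_eq0 => nxy nyz nxz.
move=> eg eg2 eg12 eh eh1 ek eg' eg1' eg21' eh' eh2' ek'.
(* [E] clears the denominators of both sides at once. *)
pose E := (x - y) ^+ 2 * (y - z) ^+ 2 * (x - z).
have nE : E != 0 by rewrite /E !mulf_neq0 ?expf_neq0.
apply: (mulfI nE).
have -> : E * k = (y - z) * (
   phi x y * (phi y z * (x - z) * (phi x y * f - phi y x * f1)
        - phi z y * (x - y) * (phi x z * f2 - phi z x * f21))
 - phi y x * (phi x z * (y - z) * (phi x y * f - phi y x * f1)
        - phi z x * (x - y) * (phi y z * f12 - phi z y * f121))).
  rewrite -eg -eg2 -eg12.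
  transitivity ((x - y) * (y - z) ^+ 2 * (x - z) * ((x - y) * k)); first by rewrite /E; ring.
  rewrite ek.
  transitivity ((y - z) * (phi x y * (x - y) * (x - z) * ((y - z) * h)
    - phi y x * (x - y) * (y - z) * ((x - z) * h1))); first by ring.
  by rewrite eh eh1; ring.
have -> : E * k' = (x - y) * (
   phi y z * (phi x y * (x - z) * (phi y z * f - phi z y * f2)
        - phi y x * (y - z) * (phi x z * f1 - phi z x * f12))
 - phi z y * (phi x z * (x - y) * (phi y z * f - phi z y * f2)
        - phi z x * (y - z) * (phi x y * f21 - phi y x * f121))).
  rewrite -eg' -eg1' -eg21'.
  transitivity ((x - y) ^+ 2 * (y - z) * (x - z) * ((y - z) * k')); first by rewrite /E; ring.
  rewrite ek'.
  transitivity ((x - y) * (phi y z * (y - z) * (x - z) * ((x - y) * h')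
    - phi z y * (x - y) * (y - z) * ((x - z) * h2'))); first by ring.
  by rewrite eh' eh2'; ring.
by rewrite /phi; ring.
Qed.

Lemma far_identity (x y z t : R) (f f1 f2 f12 g g2 h g' g1' h' : R) :
  x != y -> z != t ->
  (x - y) * g = phi x y * f - phi y x * f1 ->
  (x - y) * g2 = phi x y * f2 - phi y x * f12 ->
  (z - t) * h = phi z t * g - phi t z * g2 ->
  (z - t) * g' = phi z t * f - phi t z * f2 ->
  (z - t) * g1' = phi z t * f1 - phi t z * f12 ->
  (x - y) * h' = phi x y * g' - phi y x * g1' ->
  h = h'.
Proof.
rewrite -[x == y]subr_eq0 -[z == t]subr_eq0 => nxy nzt eg eg2 eh eg' eg1' eh'.
apply: (mulfI (mulf_neq0 nxy nzt)).
transitivity (phi z t * ((x - y) * g) - phi t z * ((x - y) * g2)).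
  by rewrite -[LHS]mulrA eh; ring.
transitivity (phi x y * ((z - t) * g') - phi y x * ((z - t) * g1')).
  by rewrite eg eg2 eg' eg1'; ring.
transitivity ((z - t) * ((x - y) * h')); last by ring.
by rewrite eh'; ring.
Qed.
End BraidAlgebra.

Section Operators.
Variable n : nat.
Implicit Types (f g : PR n) (a b c d : 'I_n).

Definition mvar (i : 'I_n) : PR n := 'X_i.

Lemma msym_var (s : 'S_n) i : msym s (mvar i) = mvar (s i).
Proof. by rewrite /mvar /msym mmapX mmap1U. Qed.

Lemma msym_beta (s : 'S_n) : msym s (beta n) = beta n.
Proof. by rewrite /beta -[_%:MP]alg_mpolyC linearZ /= msym1. Qed.

Lemma mvar_neq a b : a != b -> mvar a != mvar b.
Proof.
move=> nab; apply/eqP => /(congr1 (mcoeff U_(a))).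
by rewrite /mvar !mcoeffXU eqxx (eq_sym b) (negbTE nab); apply/eqP; rewrite oner_eq0.
Qed.

Definition phi a b : PR n := mvar a * (1 + beta n * mvar b).

Lemma msym_phi (s : 'S_n) a b : msym s (phi a b) = phi (s a) (s b).
Proof. by rewrite /phi rmorphM rmorphD rmorphM rmorph1 /= !msym_var msym_beta. Qed.

(** Divisibility of [f - s f] holds for constants and variables and passes to sums and products, the
    latter by the twisted Leibniz rule. It is what makes the choice in [divdiff] meaningful. *)
Lemma divdiff_exists a b f : a != b ->
  exists g : PR n, (mvar a - mvar b) * g = f - swapv a b f.
Proof.
move=> nab; pose ok (f : PR n) := exists g, (mvar a - mvar b) * g = f - swapv a b f.
have okD f1 f2 : ok f1 -> ok f2 -> ok (f1 + f2).
  by move=> [g1 e1] [g2 e2]; exists (g1 + g2); rewrite mulrDr e1 e2 /swapv rmorphD /=; ring.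
have okM f1 f2 : ok f1 -> ok f2 -> ok (f1 * f2).
  move=> [g1 e1] [g2 e2]; exists (g1 * f2 + swapv a b f1 * g2).
  by rewrite mulrDr mulrA e1 mulrCA e2 /swapv rmorphM /=; ring.
have okC (p : {poly int}) : ok p%:MP.
  by exists 0; rewrite mulr0 /swapv -alg_mpolyC linearZ /= msym1 subrr.
have okX i : ok (mvar i).
  rewrite /ok /swapv msym_var; case: tpermP => [->|->|_ _].
  - by exists 1; rewrite mulr1.
  - by exists (-1); rewrite mulrN mulr1 opprB.
  - by exists 0; rewrite mulr0 subrr.
rewrite -/(ok f); elim/mpolyind: f => [|p m f _ _ okf].
  exact: (okC 0).
apply: (okD _ _ _ okf); rewrite -mul_mpolyC; apply: (okM _ _ (okC p)); rewrite mpolyXE_id.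
apply: (big_ind ok) => [||i _]; [exact: (okC 1)|exact: (okM)|].
elim: (m i) => [|k IH]; first by rewrite expr0; apply: (okC 1).
by rewrite exprS; exact: (okM (mvar i) _ (okX i) IH).
Qed.

Lemma pi_opE a b f : b = a.+1 :> nat ->
  (mvar a - mvar b) * pi_op a f = phi a b * f - phi b a * msym (tperm a b) f.
Proof.
move=> ab; rewrite /pi_op (valK a) -ab (valK b).
have nab : a != b by rewrite -val_eqE /= ab; lia.
rewrite /divdiff.
have -> := epsilon_spec (inhabits 0) _ (divdiff_exists ('X_a * f + beta n * 'X_a * 'X_b * f) nab).
rewrite -/(mvar a) -/(mvar b) /swapv.
have -> : mvar a * f + beta n * mvar a * mvar b * f = phi a b * f by rewrite /phi; ring.
by rewrite rmorphM /= msym_phi tpermL tpermR.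
Qed.

(** The transposition negates both [mvar a - mvar b] and the right-hand side of [pi_opE], hence
    fixes the quotient. *)
Lemma pi_op_sym a b f : b = a.+1 :> nat -> msym (tperm a b) (pi_op a f) = pi_op a f.
Proof.
move=> ab; have nab : a != b by rewrite -val_eqE /= ab; lia.
have nz : mvar a - mvar b != 0 by rewrite subr_eq0 mvar_neq.
apply: (mulfI nz); rewrite (pi_opE _ ab).
have := congr1 (msym (tperm a b)) (pi_opE f ab).
rewrite msymM !msymB (msymM _ (phi a b)) (msymM _ (phi b a)) !msym_var !msym_phi tpermL tpermR.
rewrite -(msymMm f) tperm2 msym1m => e; apply: oppr_inj; rewrite -mulNr opprB e.
exact: (esym (opprB _ _)).
Qed.

(** Supplies the permuted defining equations that [far_identity] and [braid_identity] take as
    hypotheses. *)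
Lemma pi_op_msym (s : 'S_n) a b f : b = a.+1 :> nat ->
  (mvar (s a) - mvar (s b)) * msym s (pi_op a f) =
  phi (s a) (s b) * msym s f - phi (s b) (s a) * msym (tperm a b * s) f.
Proof.
move=> ab; have := congr1 (msym s) (pi_opE f ab).
by rewrite msymM !msymB (msymM _ (phi a b)) (msymM _ (phi b a)) !msym_var !msym_phi -msymMm.
Qed.

Lemma pi_op_far (i j : nat) f : (i.+1 < j)%N -> (j.+1 < n)%N ->
  pi_op i (pi_op j f) = pi_op j (pi_op i f).
Proof.
move=> ij jn; have [a [b [ea eb]]] := @adj_in n i ltac:(lia).
have [c [d [ec ed]]] := @adj_in n j jn.
have ab : b = a.+1 :> nat by rewrite eb ea.
have cd : d = c.+1 :> nat by rewrite ed ec.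
rewrite -ea -ec; apply/esym.
have nab : a != b by rewrite -val_eqE /= ab; lia.
have ncd : c != d by rewrite -val_eqE /= cd; lia.
have nac : a != c by rewrite -val_eqE /= ?ea ?eb ?ec ?ed; lia.
have nad : a != d by rewrite -val_eqE /= ?ea ?eb ?ec ?ed; lia.
have nbc : b != c by rewrite -val_eqE /= ?ea ?eb ?ec ?ed; lia.
have nbd : b != d by rewrite -val_eqE /= ?ea ?eb ?ec ?ed; lia.
have comm : (tperm c d * tperm a b = tperm a b * tperm c d)%g.
  exact: tperm_comm.
have := @pi_op_msym (tperm c d) a b f ab.
rewrite (@tpermD _ c d a) 1?eq_sym // (@tpermD _ c d b) 1?eq_sym // => e1.
have := @pi_op_msym (tperm a b) c d f cd.
rewrite (@tpermD _ a b c) // (@tpermD _ a b d) // => e2.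
rewrite comm in e2.
apply: (far_identity (mvar_neq nab) (mvar_neq ncd) (pi_opE f ab) e1 (pi_opE _ cd)
  (pi_opE f cd) e2 (pi_opE _ ab)).
Qed.

Lemma pi_op_braid (i : nat) f : (i.+2 < n)%N ->
  pi_op i (pi_op i.+1 (pi_op i f)) = pi_op i.+1 (pi_op i (pi_op i.+1 f)).
Proof.
move=> hi; have [a [b [ea eb]]] := @adj_in n i ltac:(lia).
have [b' [d [eb' ed]]] := @adj_in n i.+1 hi.
have ? : b' = b by apply: val_inj; rewrite /= eb' eb.
subst b'; have ab : b = a.+1 :> nat by rewrite eb ea.
have bd : d = b.+1 :> nat by rewrite ed eb.
rewrite -eb -ea.
have nab : a != b by rewrite -val_eqE /= ab; lia.
have nad : a != d by rewrite -val_eqE /= ?ea ?eb ?ec ?ed; lia.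
have nbd : b != d by rewrite -val_eqE /= ?ea ?eb ?ec ?ed; lia.
set s1 := tperm a b; set s2 := tperm b d.
have s1a : s1 a = b by rewrite /s1 tpermL.
have s1b : s1 b = a by rewrite /s1 tpermR.
have s1d : s1 d = d by rewrite /s1 tpermD.
have s2a : s2 a = a by rewrite /s2 tpermD // eq_sym.
have s2b : s2 b = d by rewrite /s2 tpermL.
have s2d : s2 d = b by rewrite /s2 tpermR.
have br : (s1 * s2 * s1 = s2 * s1 * s2)%g by apply: tperm_braid.
have G1 := pi_opE f ab.
have := @pi_op_msym s2 a b f ab; rewrite s2a s2b -/s1 => G2.
have := @pi_op_msym (s2 * s1) a b f ab; rewrite !permM s2a s2b s1a s1d -/s1 mulgA => G3.
have H1 := pi_opE (pi_op a f) bd.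
have := @pi_op_msym s1 b d (pi_op a f) bd; rewrite s1b s1d -/s2 (pi_op_sym _ ab) => H2.
have K1 := pi_opE (pi_op b (pi_op a f)) ab.
have G1' := pi_opE f bd.
have := @pi_op_msym s1 b d f bd; rewrite s1b s1d -/s2 => G2'.
have := @pi_op_msym (s1 * s2) b d f bd; rewrite !permM s1b s1d s2a s2d -/s2 mulgA -br => G3'.
have H1' := pi_opE (pi_op b f) ab.
have := @pi_op_msym s2 a b (pi_op b f) ab; rewrite s2a s2b -/s1 (pi_op_sym _ bd) => H2'.
have K1' := pi_opE (pi_op a (pi_op b f)) bd.
exact: (braid_identity (mvar_neq nab) (mvar_neq nbd) (mvar_neq nad)
  G1 G2 G3 H1 H2 K1 G1' G2' G3' H1' H2' K1').
Qed.

Lemma adj_sym_all f :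
  (forall a b, b = a.+1 :> nat -> msym (tperm a b) f = f) ->
  forall s : 'S_n, msym s f = f.
Proof.
move=> h s; have [r [r1 [<- _]]] := reduced_exists s.
elim: r r1 => [_|i r IH /= /andP [hi hr]]; first by rewrite big_nil msym1m.
have [a [b [ea eb]]] := adj_in hi.
have ab : b = a.+1 :> nat by rewrite eb ea.
by rewrite big_cons msymMm -ea (stpE ab) h ?IH.
Qed.

(** It suffices to test adjacent transpositions. Since [w0] has a reduced word with any prescribed
    first letter, the outermost operator can be taken to be [pi_op a], whose values are fixed by
    [tperm a b]. *)
Lemma pi_word_sym (r : seq nat) f (s : 'S_n) : reduced_word (w0 n) r ->
  msym s (foldl (fun g i => pi_op i g) f r) = foldl (fun g i => pi_op i g) f r.
Proof.
move=> hr; apply: adj_sym_all s => a b ab.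
rewrite -[r]revK foldl_rev.
have [q hq] := @w0_reduced_head n a ltac:(rewrite -ab; exact: ltn_ord).
rewrite (matsumoto (T := @pi_op n) _ _ f (reduced_w0_rev hr) hq) /=.
- exact: pi_op_sym.
- by move=> i j ij jn g; apply: pi_op_far.
- by move=> i hi g; apply: pi_op_braid.
Qed.

End Operators.

(** * Branching of the alternants *)

Section Branching.
Variables (R : idomainType) (b : R) (x : nat -> R) (n M : nat).
Notation Row := {ffun 'I_n -> 'I_M.+1}.
Implicit Types (r mu : Row) (al : nat -> nat) (k : nat).

Definition rowval r (j : nat) : nat :=
  if insub j is Some k then val (r k) else 0.

Lemma rowvalE r (j : 'I_n) : rowval r j = r j.
Proof. by rewrite /rowval valK. Qed.

Lemma rowval_le r j : (rowval r j <= M)%N.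
Proof. by rewrite /rowval; case: insub => // k; rewrite -ltnS ltn_ord. Qed.

(** Rows of every length share the type [Row]; pinning the positions from [k] on to 0 gives each row
    of length [k] a single representative. *)
Definition interlaced k al mu :=
  [forall j : 'I_n, if (j < k)%N then (al j <= mu j <= al j.+1)%N else mu j == ord0].

(** For interlaced rows with [k <= n] the truncated subtraction is exact, since each [mu j] is at
    most [al j.+1]. *)
Definition row_weight (y : R) k al mu : R :=
  y ^+ (\sum_(j < k.+1) al j - \sum_(j < k) rowval mu j) *
  \prod_(j < k) (1 + b * y) ^+ (al j < rowval mu j).

Fixpoint gz_sum k al : R :=
  if k is k'.+1 then
    \sum_(mu | interlaced k' al mu) row_weight (x k') k' al mu * gz_sum k' (rowval mu)
  else 1.

(** At [b = 0] these are the entries of the alternant of a Schur polynomial, with the parts listed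
    in increasing order. *)
Definition alt_fun k al (j : nat) (t : R) := t ^+ (al j + j) * (1 + b * t) ^+ (k.-1 - j).

Definition alt_det k al : R := \det (\matrix_(j < k, i < k) alt_fun k al j (x i)).

(** Induction on [c - a]: raising [c] by one multiplies the old terms by [t] and adds one new term.
    The right-hand side is, up to common factors, what the row operation in [alt_det_step]
    produces. *)
Lemma two_variable_sum (s t : R) (a c : nat) : (a <= c)%N -> (c <= M)%N ->
  (s - t) * \sum_(v < M.+1 | (a <= v <= c)%N) t ^+ (c - v) * (1 + b * t) ^+ (a < v) * s ^+ v =
  s ^+ a * (s ^+ (c - a).+1 * (1 + b * t) - t ^+ (c - a).+1 * (1 + b * s)).
Proof.
move=> ac cM.
have -> : \sum_(v < M.+1 | (a <= v <= c)%N) t ^+ (c - v) * (1 + b * t) ^+ (a < v) * s ^+ v =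
  \sum_(a <= v < c.+1) t ^+ (c - v) * (1 + b * t) ^+ (a < v) * s ^+ v.
  rewrite (big_nat_widenl a 0) // (big_nat_widen 0 c.+1 M.+1) // big_mkord.
  by apply: eq_bigl => v; rewrite ltnS.
rewrite -(subnKC ac); elim: (c - a)%N => [|d IH].
  by rewrite addn0 big_nat1 subnn ltnn !expr1; ring.
rewrite addnS big_nat_recr /=; last by rewrite leqW // leq_addr.
rewrite subnn mulrDr.
rewrite (_ : \sum_(a <= _ < _) _ = t * \sum_(a <= v < (a + d).+1)
   t ^+ (a + d - v) * (1 + b * t) ^+ (a < v) * s ^+ v); last first.
  rewrite big_distrr; apply: eq_big_nat => v /andP [_ hv] /=.
  by rewrite subSn // exprS -!mulrA.
rewrite mulrCA IH ltnS leq_addr expr1 expr0.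
rewrite (_ : (a + d - a = d)%N) ?addKn // (_ : ((a + d).+1 - a = d.+1)%N); last by lia.
by rewrite (exprS s (a + d)) exprD !exprS; ring.
Qed.

Lemma sum_delta_mul m (j : 'I_m) (c : R) (F : 'I_m -> R) :
  \sum_l (l == j)%:R * c * F l = c * F j.
Proof.
rewrite (bigD1 j) //= eqxx mul1r big1 ?addr0 // => l /negbTE ->.
by rewrite !mul0r.
Qed.

(** The minor left by the row operations of [alt_det_step] after the factors [x i - y] are taken out
    of its columns. The index [v] in row [j] runs over the values that the next pattern row may take
    at [j]. *)
Definition mid_det k al (y : R) : R := \det (\matrix_(j < k, i < k)
  \sum_(v < M.+1 | (al j <= v <= al j.+1)%N)
     y ^+ (al j.+1 - v) * (1 + b * y) ^+ (al j < v) * (x i ^+ (v + j) * (1 + b * x i) ^+ (k.-1 - j))).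

(* Row operations on the alternant: subtracting a multiple of row [j] from [1 + b y]
   times row [j + 1] makes the entry at the last variable [y] vanish. *)
Lemma alt_det_step k al : (forall j, (j < k)%N -> (al j <= al j.+1)%N) ->
  (forall j, (al j <= M)%N) -> 1 + b * x k != 0 ->
  alt_det k.+1 al = x k ^+ al 0%N * \prod_(i < k) (x k - x i) * mid_det k al (x k).
Proof.
move=> mono bnd nz; set y := x k.
have nzk : (1 + b * y) ^+ k != 0 by rewrite expf_neq0.
(* The row operations scale every row except row 0 by [1 + b * y]; this power is the determinant of
   the lower triangular matrix [L] that performs them. *)
apply: (mulfI nzk).
pose A := \matrix_(j < k.+1, i < k.+1) alt_fun k.+1 al j (x i).
pose L := \matrix_(j < k.+1, l < k.+1)
   ((l == j)%:R * (if j == 0 :> nat then 1 else 1 + b * y)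
    - (l.+1 == j)%:R * y ^+ (al j - al l).+1).
have detL : \det L = (1 + b * y) ^+ k.
  rewrite det_trig; last first.
    apply/is_trig_mxP => i j lij; rewrite mxE.
    have -> : (j == i) = false by apply/negbTE; rewrite -val_eqE /= gtn_eqF.
    have -> : (j.+1 == i) = false by apply/negbTE; rewrite gtn_eqF // ltnW.
    by rewrite !mul0r subrr.
  rewrite big_ord_recl mxE /= mul1r mul0r subr0 mul1r.
  rewrite (eq_bigr (fun _ => 1 + b * y)) ?prodr_const ?card_ord // => i _.
  by rewrite mxE eqxx /= gtn_eqF // mul0r mul1r subr0.
have LA0 i : (L *m A) ord0 i = A ord0 i.
  rewrite mxE (eq_bigr (fun l => (l == ord0)%:R * 1 * A l i)) ?sum_delta_mul ?mul1r // => l _.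
  by rewrite mxE /= mul0r subr0.
have LAS (j : 'I_k) i : (L *m A) (lift ord0 j) i =
    (x i - y) * \sum_(v < M.+1 | (al j <= v <= al j.+1)%N)
     y ^+ (al j.+1 - v) * (1 + b * y) ^+ (al j < v) * (x i ^+ (v + j) * (1 + b * x i) ^+ (k.-1 - j)).
  rewrite mxE (eq_bigr (fun l => (l == lift ord0 j)%:R * (1 + b * y) * A l i
      - (l == widen_ord (leqnSn k) j)%:R * y ^+ (al j.+1 - al j).+1 * A l i)); last first.
    move=> l _; rewrite mxE /= mulrBl; congr (_ - _).
    rewrite /bump /= add1n eqSS -val_eqE /=; case: eqP => [->|_] //.
    by rewrite !mul0r.
  rewrite sumrB !sum_delta_mul !mxE /alt_fun /= /bump /= add1n.
  transitivity ((x i ^+ j * (1 + b * x i) ^+ (k.-1 - j)) * ((x i - y) *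
    \sum_(v < M.+1 | (al j <= v <= al j.+1)%N)
     y ^+ (al j.+1 - v) * (1 + b * y) ^+ (al j < v) * x i ^+ v)); last first.
    rewrite mulrCA; congr (_ * _); rewrite big_distrr; apply: eq_bigr => v _ /=.
    by rewrite exprD; ring.
  rewrite two_variable_sum ?mono //.
  have -> : (k - j)%N = (k.-1 - j).+1 by have := ltn_ord j; lia.
  have -> : (k - j.+1)%N = (k.-1 - j)%N by lia.
  have -> : (al j.+1 + j.+1)%N = (al j + (al j.+1 - al j).+1 + j)%N.
    by have := mono _ (ltn_ord j); lia.
  by rewrite !exprD !(exprS (1 + b * x i)); ring.
transitivity (\det (L *m A)); first by rewrite det_mulmx detL.
(* In the last column the variable is [y] itself, so only row 0 contributes. *)
rewrite (expand_det_col _ ord_max) (bigD1 ord0) //= big1 ?addr0; last first.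
  move=> j nj; case: (unliftP ord0 j) nj => [j' ->|->]; last by rewrite eqxx.
  by move=> _; rewrite LAS subrr !mul0r.
rewrite LA0 mxE /alt_fun /= addn0 subn0 /cofactor add0n -/y.
have -> : row' ord0 (col' ord_max (L *m A)) = (\matrix_(j < k, i < k) \sum_(v < M.+1 | (al j <= v <= al j.+1)%N)
     y ^+ (al j.+1 - v) * (1 + b * y) ^+ (al j < v) * (x i ^+ (v + j) * (1 + b * x i) ^+ (k.-1 - j)))
     *m diag_mx (\row_i (x (nat_of_ord i) - y)).
  apply/matrixP => j i; rewrite mxE mxE LAS mul_mx_diag !mxE mulrC.
  by rewrite lift_max.
rewrite det_mulmx det_diag -/(mid_det k al y).
(* Turning each [x i - y] into [y - x i] costs a sign that cancels the sign of the cofactor at row 0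
   and column [k]. *)
rewrite (_ : \prod_i _ = (-1) ^+ k * \prod_(i < k) (y - x i)); last first.
  rewrite (eq_bigr (fun i : 'I_k => -1 * (y - x i))); last by move=> i _; rewrite mxE; ring.
  by rewrite big_split /= prodr_const card_ord.
have s1 : (-1) ^+ k * (-1) ^+ k = 1 :> R by rewrite -expr2 sqrr_sign.
transitivity (((-1) ^+ k * (-1) ^+ k) * ((1 + b * y) ^+ k *
  (y ^+ al 0%N * \prod_(i < k) (y - x i) * mid_det k al y))); first by ring.
by rewrite s1 mul1r.
Qed.

(** Distributivity over functions on all of ['I_n]: positions from [k] on are given the single value
    0 and the factor 1. *)
Lemma row_sum_distr k al (W : nat -> nat -> R) : (k <= n)%N ->
  \prod_(j < k) \sum_(v < M.+1 | (al j <= v <= al j.+1)%N) W j v =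
  \sum_(mu | interlaced k al mu) \prod_(j < k) W j (rowval mu j).
Proof.
move=> kn.
pose Q (j : 'I_n) (v : 'I_M.+1) := if (j < k)%N then (al j <= v <= al j.+1)%N else v == ord0.
pose F (j : 'I_n) (v : 'I_M.+1) := if (j < k)%N then W j v else 1.
transitivity (\prod_(j < n) \sum_(v | Q j v) F j v).
  rewrite (big_ord_widen n (fun j => \sum_(v < M.+1 | (al j <= v <= al j.+1)%N) W j v)) //.
  rewrite [LHS]big_mkcond; apply: eq_bigr => j _; rewrite /Q /F; case: ltnP => // _.
  by rewrite big_pred1_eq.
rewrite bigA_distr_big_dep; apply: eq_big => [mu|mu _].
  by apply/familyP/forallP => h j; have := h j; rewrite unfold_in.
rewrite (big_ord_widen n (fun j => W j (rowval mu j))) // [RHS]big_mkcond.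
by apply: eq_bigr => j _; rewrite /F rowvalE.
Qed.

(** Multilinearity of the determinant in its rows, carried out term by term in the Leibniz
    formula. *)
Lemma mid_det_expand k al (y : R) : (k <= n)%N ->
  mid_det k al y = \sum_(mu | interlaced k al mu)
    (\prod_(j < k) (y ^+ (al j.+1 - rowval mu j) * (1 + b * y) ^+ (al j < rowval mu j))) *
    alt_det k (rowval mu).
Proof.
move=> kn; rewrite /mid_det /determinant.
(* [X s] extends the permuted variables to natural indices, as [row_sum_distr] requires. *)
pose X (s : 'S_k) (j : nat) := if insub j is Some i then x (s i) else 0.
have XE (s : 'S_k) (i : 'I_k) : X s i = x (s i) by rewrite /X valK.
transitivity (\sum_(s : 'S_k) (-1) ^+ s * \sum_(mu | interlaced k al mu)
   \prod_(j < k) (y ^+ (al j.+1 - rowval mu j) * (1 + b * y) ^+ (al j < rowval mu j) *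
      (X s j ^+ (rowval mu j + j) * (1 + b * X s j) ^+ (k.-1 - j)))).
  apply: eq_bigr => s _; congr (_ * _).
  rewrite -(row_sum_distr al (fun j v => y ^+ (al j.+1 - v) * (1 + b * y) ^+ (al j < v) *
      (X s j ^+ (v + j) * (1 + b * X s j) ^+ (k.-1 - j)))) //.
  by apply: eq_bigr => j _; rewrite mxE XE.
rewrite (eq_bigr _ (fun _ _ => big_distrr _ _ _)) /= exchange_big /=; apply: eq_bigr => mu _.
rewrite /alt_det /determinant big_distrr; apply: eq_bigr => s _ /=.
rewrite big_split /= mulrCA; congr (_ * (_ * _)).
by apply: eq_bigr => j _; rewrite mxE XE.
Qed.

(** The exponent is regrouped as [al 0] plus the sum of the differences [al j.+1 - mu j], the form
    in which [mid_det_expand] yields it. *)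
Lemma row_weightE y k al mu : (k <= n)%N -> interlaced k al mu ->
  row_weight y k al mu = y ^+ al 0%N *
    \prod_(j < k) (y ^+ (al j.+1 - rowval mu j) * (1 + b * y) ^+ (al j < rowval mu j)).
Proof.
move=> kn /forallP il; rewrite big_split /= mulrA /row_weight; congr (_ * _).
rewrite prodrXr -exprD; congr (_ ^+ _); rewrite sumnB => [|j _].
  rewrite big_ord_recl addnBA; last first.
    apply: leq_sum => j _; have := il (widen_ord kn j).
    by rewrite /= ltn_ord (rowvalE mu (widen_ord kn j)) => /andP [].
  by congr (_ + _ - _)%N.
have := il (widen_ord kn j).
by rewrite /= ltn_ord (rowvalE mu (widen_ord kn j)) => /andP [].
Qed.

(** Induction on [k]. The product of the [x k - x i] from [alt_det_step] is the last factor of the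
    Vandermonde product, and [x k ^+ al 0] joins the coefficients of [mid_det_expand] to form
    [row_weight]. *)
Lemma alt_det_gz_sum k al : (k <= n)%N ->
  (forall j, (j.+1 < k)%N -> (al j <= al j.+1)%N) -> (forall j, (al j <= M)%N) ->
  (forall i, (i < n)%N -> 1 + b * x i != 0) ->
  alt_det k al = (\prod_(i < k) \prod_(j < i) (x i - x j)) * gz_sum k al.
Proof.
move=> kn mono bnd nz; elim: k al kn mono bnd => [|k IH] al kn mono bnd.
  by rewrite /alt_det det_mx00 big_ord0 mul1r.
have kn' := ltnW kn.
rewrite alt_det_step ?nz // mid_det_expand // big_ord_recr /= !big_distrr /=.
apply: eq_bigr => mu il; rewrite row_weightE // IH //; last by move=> j; apply: rowval_le.
  by ring.
(* The new row is again increasing, because [al j.+1] lies between [mu j] and [mu j.+1]. *)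
move=> j jk; move/forallP: il => il.
have jn : (j < n)%N by lia.
have jn1 : (j.+1 < n)%N by lia.
have := il (Ordinal jn); rewrite /= (ltnW jk) -(rowvalE mu (Ordinal jn)) => /andP [_ h1].
have := il (Ordinal jn1); rewrite /= jk -(rowvalE mu (Ordinal jn1)) => /andP [h2 _].
exact: leq_trans h1 h2.
Qed.

End Branching.

(** * The antisymmetrizer *)

Section Antisymmetrizer.
Variable n : nat.
Implicit Types (f g h : PR n) (a b : 'I_n).

Definition antisym f : PR n := \sum_(s : 'S_n) (-1) ^+ s * msym s f.

Lemma antisymD f g : antisym (f + g) = antisym f + antisym g.
Proof. by rewrite -big_split; apply: eq_bigr => s _; rewrite msymD mulrDr. Qed.

Lemma antisymN f : antisym (- f) = - antisym f.
Proof. by rewrite -sumrN; apply: eq_bigr => s _; rewrite msymN mulrN. Qed.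

Lemma antisym_msym (t : 'S_n) f : antisym (msym t f) = (-1) ^+ t * antisym f.
Proof.
rewrite /antisym (reindex_inj (mulgI t^-1%g)) big_distrr; apply: eq_bigr => s _ /=.
by rewrite -msymMm mulgA mulgV mul1g odd_permM odd_permV signr_addb mulrA.
Qed.

Lemma antisym_symM g f : (forall s : 'S_n, msym s g = g) ->
  antisym (f * g) = antisym f * g.
Proof.
by move=> sg; rewrite /antisym big_distrl; apply: eq_bigr => s _ /=; rewrite msymM sg mulrA.
Qed.

Lemma PR_double_inj f g : f + f = g + g -> f = g.
Proof.
move=> e; apply/eqP; rewrite -subr_eq0.
have : (f - g) * 2%:R == 0.
  by rewrite mulr_natr mulr2n addrACA -opprD e subrr.
rewrite mulf_eq0 => /orP [//|].
have -> : (2%:R : PR n) = (2%:R : int)%:P%:MP by rewrite !rmorph_nat.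
by rewrite mpolyC_eq0 polyC_eq0.
Qed.

Definition staircase : PR n :=
  \prod_(k < n) (mvar k ^+ (n.-1 - k) * (1 + beta n * mvar k) ^+ k).

(** From [a] to [b] the exponent of the variable drops by one and that of [1 + beta n * mvar k]
    rises by one. Hence one factor [mvar a] and one factor [1 + beta n * mvar b] are left over from
    a product symmetric in both variables. *)
Lemma staircase_split a b : b = a.+1 :> nat ->
  exists2 h, staircase = phi a b * h & msym (tperm a b) h = h.
Proof.
move=> ab; have nba : b != a by rewrite -val_eqE /= ab; lia.
have bn := ltn_ord b.
pose rest : PR n := \prod_(k < n | (k != a) && (k != b))
  (mvar k ^+ (n.-1 - k) * (1 + beta n * mvar k) ^+ k).
exists ((mvar a * mvar b) ^+ (n.-1 - b) *
  ((1 + beta n * mvar a) * (1 + beta n * mvar b)) ^+ a * rest).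
  rewrite /staircase (bigD1 a) //= (bigD1 b) //= -/rest.
  have -> : (n.-1 - a)%N = (n.-1 - b).+1 by lia.
  by rewrite ab /phi !exprMn !exprS; ring.
have mvar1 (s : 'S_n) c : msym s (1 + beta n * mvar c) = 1 + beta n * mvar (s c).
  by rewrite msymD msym1 msymM msym_beta msym_var.
rewrite !msymM !rmorphXn /= !msymM !mvar1 !msym_var tpermL tpermR.
rewrite (mulrC (mvar b)) (mulrC (1 + beta n * mvar b)); congr (_ * _).
rewrite /rest rmorph_prod /=; apply: eq_bigr => k /andP [ka kb].
by rewrite msymM !rmorphXn /= mvar1 msym_var tpermD // eq_sym.
Qed.

(** Twice [antisym u] is [antisym (u - msym t u)]. With [g = pi_op a f] fixed by [t], the case
    [u = phi a b * h * g] leaves [(phi a b - phi b a) * h * g]. As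
    [phi a b - phi b a = mvar a - mvar b], the defining equation of [pi_op] turns this into the same
    difference for [f]. *)
Lemma antisym_pi_op (i : nat) f : (i.+1 < n)%N ->
  antisym (staircase * pi_op i f) = antisym (staircase * f).
Proof.
move=> hi; have [a [b [ea eb]]] := adj_in hi.
have ab : b = a.+1 :> nat by rewrite eb ea.
have nab : a != b by rewrite -val_eqE /= ab; lia.
rewrite -ea; set t := tperm a b; set g := pi_op a f.
have tg : msym t g = g by apply: pi_op_sym.
have [h -> th] := staircase_split ab.
have skew u : antisym u = - antisym (msym t u).
  by rewrite antisym_msym odd_tperm nab expr1 mulN1r opprK.
have double u : antisym u + antisym u = antisym (u - msym t u).
  by rewrite antisymD antisymN -skew.
have tphi u : msym t (phi a b * h * u) = phi b a * h * msym t u.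
  by rewrite (msymM _ _ u) (msymM _ _ h) th msym_phi tpermL tpermR.
apply: PR_double_inj; rewrite (double (phi a b * h * g)) (double (phi a b * h * f)).
rewrite (tphi g) (tphi f) tg; congr antisym.
transitivity (((mvar a - mvar b) * g) * h); first by rewrite /phi; ring.
by rewrite /g (pi_opE _ ab) -/t; ring.
Qed.

Lemma antisym_word (s : seq nat) f : all (fun i => i.+1 < n)%N s ->
  antisym (staircase * foldl (fun f i => pi_op i f) f s) = antisym (staircase * f).
Proof.
elim: s f => [//|i s IH] f /= /andP [hi hs].
exact: etrans (IH _ hs) (antisym_pi_op f hi).
Qed.

Definition xnat (i : nat) : PR n := if insub i is Some k then mvar k else 0.

Lemma xnatE (i : 'I_n) : xnat i = mvar i.
Proof. by rewrite /xnat valK. Qed.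

Definition diag_term al : PR n := \prod_(j < n) alt_fun (beta n) n al j (mvar j).

Lemma msym_diag_term (s : 'S_n) al :
  msym s (diag_term al) = \prod_(j < n) alt_fun (beta n) n al j (mvar (s j)).
Proof.
rewrite /diag_term rmorph_prod /=; apply: eq_bigr => j _.
by rewrite /alt_fun msymM !rmorphXn /= msymD msym1 msymM msym_beta msym_var.
Qed.

Lemma antisym_diag_term al : antisym (diag_term al) = alt_det (beta n) xnat n al.
Proof.
rewrite /antisym /alt_det /determinant; apply: eq_bigr => s _; congr (_ * _).
by rewrite msym_diag_term; apply: eq_bigr => j _; rewrite mxE xnatE.
Qed.

(** The product is the image under [w0] of the diagonal term of the alternant with reversed
    exponents, so antisymmetrizing it gives the alternant up to the sign of [w0]. *)
Lemma antisym_monomial (lam : nat -> nat) :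
  antisym (staircase * \prod_(k < n) mvar k ^+ lam k) =
  (-1) ^+ w0 n * alt_det (beta n) xnat n (fun j => lam (n.-1 - j)%N).
Proof.
rewrite -antisym_diag_term -antisym_msym; congr antisym.
rewrite msym_diag_term [RHS](reindex_inj rev_ord_inj) /= -big_split.
apply: eq_bigr => k _ /=; rewrite permE rev_ordK /alt_fun.
have kn := ltn_ord k.
have -> : (n.-1 - (n - k.+1) = k)%N by lia.
have -> : (n - k.+1 = n.-1 - k)%N by lia.
by rewrite exprD; ring.
Qed.

Lemma one_beta_neq0 (i : nat) : (i < n)%N -> 1 + beta n * xnat i != 0.
Proof.
move=> hi; rewrite (xnatE (Ordinal hi)); apply/eqP.
move/(congr1 (mcoeff U_(Ordinal hi))).
rewrite mcoeffD mcoeff1 mnm1_eq0 /beta mcoeffCM mcoeffXU eqxx mulr1 add0r mcoeff0.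
by apply/eqP; rewrite polyX_eq0.
Qed.

Variable M : nat.

(** Below a zero row only the zero row interlaces. This identifies the alternant of the zero
    partition with the Vandermonde product. *)
Lemma gz_sum_zero k al : (k <= n)%N -> (forall j, al j = 0%N) ->
  gz_sum (beta n) xnat n M k al = 1.
Proof.
elim: k al => [//|k IH] al kn al0 /=.
rewrite (big_pred1 [ffun => ord0]) => [|mu].
  have rv j : rowval ([ffun => ord0] : {ffun 'I_n -> 'I_M.+1}) j = 0%N.
    by rewrite /rowval; case: insub => // c; rewrite ffunE.
  rewrite IH // ?(ltnW kn) // mulr1 /row_weight !big1 ?subn0 ?mulr1 // => j _; rewrite ?rv ?al0 //.
apply/forallP/eqP => [h|-> j].
  apply/ffunP => j; rewrite ffunE; apply/val_inj; have := h j; case: ltnP => _ => [|/eqP -> //].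
  by rewrite !al0 leqn0 => /eqP.
by rewrite ffunE !al0 eqxx if_same.
Qed.

(** The Lascoux polynomial is symmetric, hence leaves the antisymmetrizer as a factor. The resulting
    equation has the sign of [w0] and the nonzero Vandermonde product [V] on both sides, and both
    cancel. *)
Lemma lascoux_gz_sum (lam : n.-tuple nat) (s : seq nat) :
  sorted geq lam -> (forall j, nth 0%N lam j <= M)%N -> reduced_word (w0 n) s ->
  lascoux_word s lam = gz_sum (beta n) xnat n M n (fun j => nth 0%N lam (n.-1 - j)).
Proof.
move=> slam lamM hs; set al := fun j => _.
pose V : PR n := \prod_(i < n) \prod_(j < i) (xnat i - xnat j).
have nzV : V != 0.
  apply/prodf_neq0 => i _; apply/prodf_neq0 => j _.
  have jn : (j < n)%N by apply: ltn_trans (ltn_ord j) (ltn_ord i).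
  rewrite (xnatE i) (xnatE (Ordinal jn)) subr_eq0 mvar_neq //.
  by rewrite -val_eqE /= gtn_eqF.
have d0 : alt_det (beta n) xnat n (fun=> 0%N) = V.
  rewrite (@alt_det_gz_sum _ _ _ n M) //; last exact: one_beta_neq0.
  by rewrite gz_sum_zero // mulr1.
have mono j : (j.+1 < n)%N -> (al j <= al j.+1)%N.
  move=> jn; have := sortedP 0%N slam (n.-1 - j.+1)%N; rewrite size_tuple /al.
  have -> : (n.-1 - j)%N = (n.-1 - j.+1).+1 by lia.
  by apply; lia.
have dal : alt_det (beta n) xnat n al = V * gz_sum (beta n) xnat n M n al.
  rewrite (@alt_det_gz_sum _ _ _ n M) // => [j|]; [exact: lamM|exact: one_beta_neq0].
have lasE : lascoux_word s lam =
    foldl (fun f i => pi_op i f) (\prod_(k < n) mvar k ^+ nth 0%N lam k) s.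
  by rewrite /lascoux_word; congr foldl; apply: eq_bigr => k _; rewrite (tnth_nth 0%N).
have := antisym_word (\prod_(k < n) mvar k ^+ nth 0%N lam k) (proj1 hs).
rewrite -lasE antisym_symM; last by move=> t; rewrite lasE; apply: pi_word_sym.
have := antisym_monomial (fun _ => 0%N); rewrite big1 ?mulr1 // => ->.
rewrite antisym_monomial d0 -/al dal -!mulrA.
by move/(mulfI (negbT (signr_eq0 _ _)))/(mulfI nzV).
Qed.
End Antisymmetrizer.

(** * Edges of efficient patterns *)

Local Open Scope nat_scope.

Lemma validposE n i j : validpos n i j = (i + j < n).
Proof. by rewrite /validpos; lia. Qed.

Section Edges.
Variables (n : nat) (a : nat -> nat -> nat) (c : nat -> nat -> bool).

(* The edges forced by the entries [a] and the circles [c] of an efficient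
   pattern; [edgeL] combines conditions (3), (4) and (5). *)
Definition edgeR i j := [&& 0 < i, a i j == a i.-1 j.+1 & c i j].

Fixpoint edgeL i j := if i is i'.+1 then
    (a i j == a i' j) &&
    (if i' is _.+1 then (a i' j < a i' j.+1) || edgeR i' j && edgeL i' j.+1 else true)
  else false.

Arguments edgeL : simpl never.

Lemma edgeLSS i j : edgeL i.+2 j =
  (a i.+2 j == a i.+1 j) && ((a i.+1 j < a i.+1 j.+1) || edgeR i.+1 j && edgeL i.+1 j.+1).
Proof. by []. Qed.

Lemma edgeL_eq i j : edgeL i j -> 0 < i /\ a i j = a i.-1 j.
Proof. by case: i => // i /andP [/eqP]. Qed.

Hypothesis il : forall i j, 0 < i -> i + j < n -> a i.-1 j <= a i j <= a i.-1 j.+1.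
Hypothesis forced : forall i j, 0 < i -> i + j < n -> a i j = a i.-1 j -> c i j.

(** Neighbours in a row are separated by the entry below them. *)
Lemma row_mono i q q' : q <= q' -> i + q' < n -> a i q <= a i q'.
Proof.
move=> /subnKC <-; elim: (q' - q) => [|d IH] h; first by rewrite addn0.
rewrite addnS in h *; have h1 := IH ltac:(lia).
have /= h2 := @il i.+1 (q + d) isT ltac:(lia); lia.
Qed.

Lemma diag_mono p q p' q' : p <= p' -> p + q = p' + q' -> p' + q' < n -> a p' q' <= a p q.
Proof.
move=> /subnKC <-; elim: (p' - p) q' => [|d IH] q' e h.
  by rewrite addn0 in e *; rewrite (_ : q' = q) //; lia.
have := @il (p + d.+1) q' ltac:(lia) h; have := IH q'.+1 ltac:(lia) ltac:(lia).
by rewrite addnS /=; lia.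
Qed.

Lemma edgeR_equal i j : 0 < i -> i + j < n -> a i j = a i.-1 j -> a i j = a i.-1 j.+1 ->
  edgeR i j.
Proof. by move=> i0 h e1 e2; rewrite /edgeR i0 -e2 eqxx forced. Qed.

(** Two edges to a common upper entry make the neighbours equal, which squeezes the entry below and
    creates both lower edges. Conversely, lower edges exclude the strict inequality in [edgeL], and
    its other alternative is the pair of upper edges. *)
Lemma edge_diamond i j : 0 < i -> i + j.+1 < n ->
  (edgeR i j && edgeL i j.+1) = (edgeL i.+1 j && edgeR i.+1 j).
Proof.
case: i => // i _ h; have /= il1 := @il i.+2 j isT ltac:(lia).
apply/idP/idP => /andP [].
  move=> eR eL; have [_ /= e2] := edgeL_eq eL; have /and3P [_ /eqP /= e1 _] := eR.
  have e3 : a i.+2 j = a i.+1 j by lia.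
  by rewrite edgeLSS eR eL e3 eqxx orbT edgeR_equal //=; lia.
rewrite edgeLSS => /andP [/eqP e1 /orP [lt|//]] /and3P [_ /eqP /= e2 _]; lia.
Qed.

Lemma chain_top k i : i <= k -> exists m, [/\ m <= i,
  (forall p, m < p <= i -> edgeR p (k - p)) & 0 < m -> ~~ edgeR m (k - m)].
Proof.
elim: i => [|i IH] ik; first by exists 0; split=> // p; lia.
case: (boolP (edgeR i.+1 (k - i.+1))) => e; last first.
  by exists i.+1; split=> // p; lia.
have [m [h1 h2 h3]] := IH (ltnW ik); exists m; split=> //; first exact: leqW.
move=> p; have [->//|pi] := eqVneq p i.+1.
by move=> hp; apply: h2; lia.
Qed.

(* Assume that the equal entries [a i j = a i j.+1 = v] have no edge [edgeL i.+1 j]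
   below them.  Let [k = i + j], and let [m] be the top row reached from [(i, j)]
   by right edges, that is, along the diagonal [p + q = k].  Then [left_side]
   is a union of components of the edge graph containing [(i, j)] but not
   [(i, j.+1)]; so condition (7) follows from the choice of edges. *)
Section Separation.
Variables (i j v m : nat).
Hypotheses (i0 : 0 < i) (hij : i + j.+1 < n) (av : a i j = v) (av1 : a i j.+1 = v).
Hypothesis nL : ~~ edgeL i.+1 j.
Let k := i + j.
Hypotheses (mi : m <= i) (chain : forall p, m < p <= i -> edgeR p (k - p)).
Hypothesis top : 0 < m -> ~~ edgeR m (k - m).

Lemma chain_val p : m <= p <= i -> a p (k - p) = v.
Proof.
case/andP=> mp pi; rewrite -(subKn pi).
have: i - p <= i - m by lia.
elim: (i - p) => [|d IH] hd; first by rewrite subn0 /k addKn.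
have := chain (p := i - d) ltac:(lia) => /and3P [_ /eqP + _].
rewrite (IH (ltnW hd)) => ->.
have -> : (k - (i - d)).+1 = k - (i - d.+1) by rewrite /k; lia.
have -> : (i - d).-1 = i - d.+1 by lia.
by [].
Qed.

(** A left edge from diagonal [k.+1] to an entry [v] on diagonal [k] would propagate to [(i.+1, j)],
    against [nL]. From below it climbs by the recursion of [edgeL]; from above it descends through
    [edge_diamond], using the right edges of the chain. *)
Lemma no_crossing p : m < p <= k.+1 -> a p.-1 (k.+1 - p) = v -> ~~ edgeL p (k.+1 - p).
Proof.
move=> /andP [mp pk] pv; apply/negP => eL.
have /orP [ip|pi] := leq_total i.+1 p.
  move: pv eL; rewrite -(subnKC ip); have : i.+1 + (p - i.+1) <= k.+1 by lia.
  elim: (p - i.+1) => [|d IH] hd pv eL.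
    by move: nL eL; rewrite addn0 /k subSS addKn => /negbTE ->.
  have [_ e1] := edgeL_eq eL.
  move: e1 eL pv; rewrite addnS /=; have -> : k.+1 - (i.+1 + d).+1 = k - (i.+1 + d) by lia.
  move=> e1 eL pv; set q := k - (i.+1 + d) in e1 eL pv *.
  have r1 : a (i + d).+1 q <= a (i + d).+1 q.+1 by apply: row_mono; rewrite /q /k; lia.
  have r2 : a (i + d).+1 q.+1 <= a i j.+1 by apply: diag_mono; rewrite /q /k; lia.
  move: eL; rewrite addSn edgeLSS => /andP [_ /orP [lt|/andP [_ eL]]].
    by rewrite addSn in pv; lia.
  have eq1 : k.+1 - (i.+1 + d) = q.+1 by rewrite /q; lia.
  have [_ /= e2] := edgeL_eq eL.
  by apply: IH; rewrite ?eq1 ?addSn //= in pv *; lia.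
have [pi'|pi'] := eqVneq p i.+1.
  by move: nL eL; rewrite pi' /k subSS addKn => /negbTE ->.
have pin : p <= i by lia.
suff H d : d <= i.+1 - p -> edgeL (p + d) (k.+1 - (p + d)).
  by have := H _ (leqnn _); move: nL; rewrite subnKC ?leqW // /k subSS addKn => /negbTE ->.
elim: d => [|d IH] hd; first by rewrite addn0.
have {}IH := IH (ltnW hd).
have cR : edgeR (p + d) (k - (p + d)) by apply: chain; lia.
have eq1 : k.+1 - (p + d) = (k - (p + d)).+1 by rewrite /k; lia.
have := @edge_diamond (p + d) (k - (p + d)) ltac:(lia) ltac:(rewrite /k; lia).
by rewrite cR -eq1 IH addnS subSS => /esym /andP [].
Qed.

(** If the chain stops at a row [m > 0] although the entry to the upper right of its top is also
    [v], that entry lies on diagonal [k] but need not be separated from [(i, j.+1)]; the rows above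
    [m] are then discarded. By [left_lt] no edge from the rest leads into them. *)
Definition left_side p q := [&& p + q < n, a p q == v, p + q <= k &
  [|| m <= p, m == 0 | a m.-1 (k - m).+1 != v]].

Lemma left_lt : 0 < m -> a m.-1 (k - m).+1 = v -> a m.-1 (k - m) < v.
Proof.
move=> m0 e; have cv := @chain_val m ltac:(lia).
have /= h := @il m (k - m) m0 ltac:(rewrite /k; lia).
have : a m (k - m) != a m.-1 (k - m).
  apply/negP => /eqP e1; have := top m0; rewrite edgeR_equal //; first by rewrite /k; lia.
  by rewrite cv e.
by rewrite cv in h *; lia.
Qed.

Lemma left_side_edgeR p q : edgeR p q -> p + q < n -> left_side p q = left_side p.-1 q.+1.
Proof.
move=> eR h; have /and3P [p0 /eqP e _] := eR.
rewrite /left_side -e (_ : p.-1 + q.+1 = p + q); last by lia.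
apply/and4P/and4P => -[h1 /eqP h2 h3 h4]; split=> //; rewrite ?h2 //.
  case/or3P: h4 => [h4|->|->]; rewrite ?orbT //.
  have [//|ge] := leqP m p.-1.
  have pm : p = m by lia.
  case: (eqVneq m 0) => //= m0; apply/eqP => e3.
  have lt := left_lt ltac:(lia) e3; rewrite pm in h3 h2 eR e h.
  have [qk|qk] := eqVneq q (k - m).
    by have := top ltac:(lia); rewrite -qk eR.
  have : a m.-1 q.+1 <= a m.-1 (k - m) by apply: row_mono; rewrite /k in h3 qk *; lia.
  by rewrite -e h2; lia.
case/or3P: h4 => [h4|->|->]; rewrite ?orbT //.
by rewrite (leq_trans h4 (leq_pred p)).
Qed.

Lemma left_side_edgeL p q : edgeL p q -> p + q < n -> left_side p q = left_side p.-1 q.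
Proof.
move=> eL h; have [p0 e] := edgeL_eq eL.
rewrite /left_side -e.
apply/and4P/and4P => -[h1 /eqP h2 h3 h4]; split=> //; rewrite ?h2 //; try lia.
- case/or3P: h4 => [h4|->|->]; rewrite ?orbT //.
  have [//|ge] := leqP m p.-1.
  have pm : p = m by lia.
  case: (eqVneq m 0) => //= m0; apply/eqP => e3.
  have lt := left_lt ltac:(lia) e3; rewrite pm in h3 h2 eL e h.
  have : a m.-1 q <= a m.-1 (k - m) by apply: row_mono; rewrite /k in h3 *; lia.
  by rewrite -e h2; lia.
(* Here the edge would step from diagonal [k.+1] onto diagonal [k]. Below row [m] this is excluded
   by [no_crossing]; otherwise monotonicity along the diagonal forces the entry at the upper right
   of the chain top to be [v]. *)
- case: (ltnP k (p + q)) => // kpq; exfalso.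
  have qE : q = k.+1 - p by lia.
  have [mp|pm] := ltnP m p.
    have := @no_crossing p ltac:(rewrite mp; lia); rewrite -qE -e eL => H.
    by have := H h2.
  case/or3P: h4 => [|/eqP|/eqP] h4; try lia.
  have cv := @chain_val m ltac:(lia).
  have /= hm := @il m (k - m) ltac:(lia) ltac:(rewrite /k; lia).
  have : a m.-1 (k - m).+1 <= a p.-1 q by apply: diag_mono; rewrite /k in kpq qE *; lia.
  by rewrite -e h2; lia.
Qed.
End Separation.
End Edges.

(** * Efficient patterns reconstructed from entries and circles *)

Section Patterns.
Variables (n M : nat).
Implicit Types (P : patT n M) (lam : n.-tuple nat) (p q : 'I_n * 'I_n).

Lemma lookupE (T : Type) (d : T) (F : 'I_n * 'I_n -> T) p : lookup d F p.1 p.2 = F p.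
Proof. by case: p => i j; rewrite /lookup /= !valK. Qed.

Lemma lookup_out (T : Type) (d : T) (F : 'I_n * 'I_n -> T) i j :
  ~~ ((i < n) && (j < n)) -> lookup d F i j = d.
Proof.
rewrite /lookup; case: insubP => [u -> _ /=|//].
by case: insubP => [w ->|].
Qed.

Lemma lookup_in (T : Type) (d : T) (F : 'I_n * 'I_n -> T) i j :
  (i < n) && (j < n) -> exists p, [/\ p.1 = i :> nat, p.2 = j :> nat & lookup d F i j = F p].
Proof.
case/andP=> hi hj; exists (Ordinal hi, Ordinal hj); split=> //.
exact: (lookupE d F (Ordinal hi, Ordinal hj)).
Qed.

Lemma lookup_true (F : 'I_n * 'I_n -> bool) i j : lookup false F i j ->
  exists p, [/\ p.1 = i :> nat, p.2 = j :> nat & F p].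
Proof.
case: (boolP ((i < n) && (j < n))) => [h|h]; last by rewrite lookup_out.
by have [p [h1 h2 ->]] := lookup_in false F h; exists p.
Qed.

Lemma canonicalP P : canonical P <->
  (forall p, n <= p.1 + p.2 -> [/\ pA P p = 0 :> nat, p \notin pC P, p \notin pEL P & p \notin pER P])
  /\ (forall p, p.1 = 0 :> nat -> p \notin pEL P /\ p \notin pER P).
Proof.
split.
  case/andP=> /forallP h1 /forallP h2; split=> p hp.
    have := h1 p; rewrite validposE -leqNgt hp /= => /and4P [/eqP ? ? ? ?]; by split.
  by have := h2 p; rewrite /= hp eqxx /= => /andP.
case=> h1 h2; apply/andP; split; apply/forallP => p; apply/implyP.
  by rewrite validposE -leqNgt => /h1 [h -> -> ->]; rewrite /= h.
by move/eqP/h2 => [-> ->].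
Qed.

Definition gz_data lam (a : nat -> nat -> nat) (c : nat -> nat -> bool) :=
  [/\ forall j, j < n -> a 0 j = nth 0 lam (n.-1 - j),
      forall i j, 0 < i -> i + j < n -> a i.-1 j <= a i j <= a i.-1 j.+1,
      forall j, j < n -> c 0 j &
      forall i j, 0 < i -> i + j < n -> a i j = a i.-1 j -> c i j].

(** Right edges: for distinct upper neighbours they follow from equality and the circle, for an
    equal triple from efficiency. Left edges go by induction on the row: at distinct upper
    neighbours equality forces them, and at equal ones the right edge exists, so the diamond
    condition passes the question to the row above. *)
Lemma enhanced_data P lam : enhancedGZ P lam -> efficient P ->
  [/\ canonical P, gz_data lam (ent P) (circ P),
      forall i j, i + j < n -> eL P i j = edgeL (ent P) (circ P) i j &
      forall i j, i + j < n -> eR P i j = edgeR (ent P) (circ P) i j].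
Proof.
case=> can [row0 [ilv [c0 [eLv [eRv [dia [c4 [c5 [c6 [_ _]]]]]]]]]] eff.
have {}ilv i j : 0 < i -> i + j < n -> ent P i.-1 j <= ent P i j <= ent P i.-1 j.+1.
  by move=> i0 h; apply: ilv; rewrite ?validposE.
have effR i j : 0 < i -> i + j < n -> ent P i.-1 j = ent P i.-1 j.+1 ->
    ent P i j = ent P i.-1 j -> eR P i j.
  move=> i0 h e1 e2; case: (boolP (eR P i j)) => // nR; case: eff.
  by exists i, j; split; rewrite ?validposE.
have no0 j : eL P 0 j = false /\ eR P 0 j = false.
  have [_ h] := (canonicalP P).1 can.
  split; apply/negP => /lookup_true [p [h1 _ h2]]; have [] := h p h1; by rewrite h2.
have ER i j : i + j < n -> eR P i j = edgeR (ent P) (circ P) i j.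
  move=> h; rewrite /edgeR; case: posnP => [->|i0] /=; first by have [_ ->] := no0 j.
  apply/idP/andP => [e|[/eqP e cc]].
    by have [-> ->] := eRv i j ltac:(rewrite validposE; lia) e.
  have il1 := ilv i j i0 h.
  case: (ltnP (ent P i.-1 j) (ent P i.-1 j.+1)) => lt; last by apply: effR => //; lia.
  by apply: c6; rewrite ?validposE.
have forced i j : 0 < i -> i + j < n -> ent P i j = ent P i.-1 j -> circ P i j.
  move=> i0 h e; have il1 := ilv i j i0 h.
  case: (ltnP (ent P i.-1 j) (ent P i.-1 j.+1)) => lt.
    by have /andP [] := c5 i j i0 ltac:(rewrite validposE; lia) lt e.
  have r : eR P i j by apply: effR => //; lia.
  by have [] := eRv i j ltac:(rewrite validposE; lia) r.
split=> //.
elim=> [|i IH] j h; first by have [-> _] := no0 j.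
have il1 := ilv i.+1 j isT h; rewrite /= in il1.
case: i IH h il1 => [|i] IH h il1.
  rewrite /edgeL andbT; apply/idP/eqP => [e|e].
    by have [] := eLv 1 j ltac:(rewrite validposE; lia) e.
  case: (ltnP (ent P 0 j) (ent P 0 j.+1)) => lt.
    by have /andP [] := c5 1 j isT ltac:(rewrite validposE; lia) lt e.
  by have /and3P [] := c4 j ltac:(lia) ltac:(lia).
rewrite edgeLSS.
have d := dia i.+1 j isT ltac:(rewrite validposE; lia).
rewrite -ER -?IH; try lia.
apply/idP/andP => [e|[/eqP e]].
  have [-> _] := eLv i.+2 j ltac:(rewrite validposE; lia) e; rewrite eqxx; split=> //.
  have [e2 _] := eLv i.+2 j ltac:(rewrite validposE; lia) e; rewrite /= in e2.
  case: ltnP => //= lt; rewrite d e effR //=; lia.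
case/orP=> [lt|dd].
  by have /andP [] := c5 i.+2 j isT ltac:(rewrite validposE; lia) lt e.
by move: d; rewrite dd => /esym /andP [].
Qed.

(** By contraposition: without the left edge, [left_side] is closed under adjacency and separates
    the two entries. *)
Lemma connected_edgeL P lam i j :
  canonical P -> gz_data lam (ent P) (circ P) ->
  (forall i j, i + j < n -> eL P i j = edgeL (ent P) (circ P) i j) ->
  (forall i j, i + j < n -> eR P i j = edgeR (ent P) (circ P) i j) ->
  0 < i -> i + j.+1 < n -> ent P i j = ent P i j.+1 ->
  connected P i j i j.+1 -> edgeL (ent P) (circ P) i.+1 j.
Proof.
move=> /canonicalP [can1 can2] [_ il _ forced] EL ER i0 hij e.
have hi : i < n by lia.
have hj : j < n by lia.
have hj1 : j.+1 < n by lia.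
rewrite /connected !insubT => con.
case: (boolP (edgeL _ _ _ _)) => // nL; exfalso.
have [m [mi chain top]] := @chain_top (ent P) (circ P) (i + j) i (leq_addr _ _).
pose S := [pred p : 'I_n * 'I_n | left_side n (ent P) i j (ent P i j) m p.1 p.2].
have inEL p : p \in pEL P -> [/\ 0 < p.1, p.1 + p.2 < n & edgeL (ent P) (circ P) p.1 p.2].
  move=> pe; have p0 : 0 < p.1.
    by rewrite lt0n; apply/eqP => /can2 []; rewrite pe.
  have pn : p.1 + p.2 < n by rewrite ltnNge; apply/negP => /can1 []; rewrite pe.
  by split=> //; rewrite -EL // /eL lookupE.
have inER p : p \in pER P -> [/\ 0 < p.1, p.1 + p.2 < n & edgeR (ent P) (circ P) p.1 p.2].
  move=> pe; have p0 : 0 < p.1.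
    by rewrite lt0n; apply/eqP => /can2 []; rewrite pe.
  have pn : p.1 + p.2 < n by rewrite ltnNge; apply/negP => /can1 []; rewrite pe.
  by split=> //; rewrite -ER // /eR lookupE.
have edge p q :
    ((p \in pEL P) && (val q.1 == (val p.1).-1) && (val q.2 == val p.2))
    || ((p \in pER P) && (val q.1 == (val p.1).-1) && (val q.2 == (val p.2).+1)) ->
    (p \in S) = (q \in S).
  case/orP=> /andP [/andP [pe /eqP q1] /eqP q2]; rewrite /= in q1 q2; rewrite !inE q1 q2.
    have [p0 pn pL] := inEL p pe.
    exact: (left_side_edgeL il forced i0 hij erefl (esym e) nL mi chain top).
  have [p0 pn pR] := inER p pe.
  exact: (left_side_edgeR il forced i0 hij erefl (esym e) nL mi chain top).
have clo : closed (adj P) S.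
  by move=> p q /orP [] /edge.
(* [(i, j)] lies on diagonal [k = i + j], whereas [(i, j.+1)] lies on the next one and so outside
   [S]. *)
have := closed_connect clo con; rewrite !inE /left_side /= mi eqxx leqnn.
by rewrite addnS ltnn !andbF andbT /=; lia.
Qed.

(** Every equal triple has its right edge ([triR]), which gives efficiency; the condition on paths
    of edges is [connected_edgeL]. *)
Lemma data_enhanced P lam :
  canonical P -> gz_data lam (ent P) (circ P) ->
  (forall i j, i + j < n -> eL P i j = edgeL (ent P) (circ P) i j) ->
  (forall i j, i + j < n -> eR P i j = edgeR (ent P) (circ P) i j) ->
  enhancedGZ P lam /\ efficient P.
Proof.
move=> can gz EL ER; have [row0 il c0 forced] := gz.
have triR i j : 0 < i -> i + j < n -> ent P i j = ent P i.-1 j -> ent P i.-1 j = ent P i.-1 j.+1 ->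
    eR P i j.
  by move=> i0 h e1 e2; rewrite ER //; apply: (edgeR_equal forced); rewrite // -e2.
split; last first.
  by case=> i [j [i0 v e1 e2]]; rewrite validposE in v; rewrite triR.
split=> //; split=> //; split.
  by move=> i j i0; rewrite validposE; apply: il.
split=> //; split.
  move=> i j; rewrite validposE => h; rewrite EL // => /edgeL_eq [i0 e].
  by split=> //; apply: forced.
split.
  by move=> i j; rewrite validposE => h; rewrite ER // => /and3P [i0 /eqP e cc].
split.
  move=> i j i0; rewrite validposE => h; rewrite !EL ?ER; try lia.
  exact: (edge_diamond il forced).
split.
  move=> j h e; have /= il1 := il 1 j isT h.
  have e1 : ent P 1 j = ent P 0 j by lia.
  by rewrite forced // triR // EL // /edgeL e1 eqxx.
split.
  move=> i j i0; rewrite validposE => h lt e; rewrite forced //= EL //.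
  case: i i0 h lt e => // -[|i] _ h lt e; first by rewrite /edgeL e eqxx.
  by rewrite edgeLSS e eqxx /=; rewrite /= in lt; rewrite lt.
split.
  by move=> i j i0; rewrite validposE => h lt e cc; rewrite ER // /edgeR i0 e eqxx.
split.
  move=> i j i0; rewrite validposE => h e1 e2 con; rewrite forced // triR // andbT /= EL //.
  case: i i0 h e1 e2 con => // -[|i] _ h e1 e2 con; first by rewrite /edgeL e2 eqxx.
  by apply: (connected_edgeL can gz EL ER) => //; lia.
by move=> i j i0; rewrite validposE => h e1 e2 cc; rewrite triR // orbT.
Qed.
End Patterns.

Local Open Scope ring_scope.

(** * Sums over patterns *)

Section FfunCons.
Variables (T : finType) (k : nat).

Definition ffun_cons (t : T) (g : {ffun 'I_k -> T}) : {ffun 'I_k.+1 -> T} :=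
  [ffun i => oapp g t (unlift ord0 i)].

Lemma ffun_cons0 t g : ffun_cons t g ord0 = t.
Proof. by rewrite ffunE unlift_none. Qed.

Lemma ffun_consS t g i : ffun_cons t g (lift ord0 i) = g i.
Proof. by rewrite ffunE liftK. Qed.

Lemma big_ffun_cons (V : nmodType) (p : pred {ffun 'I_k.+1 -> T}) (F : {ffun 'I_k.+1 -> T} -> V) :
  \sum_(f | p f) F f = \sum_t \sum_(g | p (ffun_cons t g)) F (ffun_cons t g).
Proof.
rewrite pair_big_dep /= (reindex (fun u : T * {ffun 'I_k -> T} => ffun_cons u.1 u.2)) //=.
exists (fun f => (f ord0, [ffun i => f (lift ord0 i)])) => [[t g] _|f _] /=.
  by rewrite ffun_cons0; congr pair; apply/ffunP => i; rewrite ffunE ffun_consS.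
apply/ffunP => i; case: (unliftP ord0 i) => [j|] ->; first by rewrite ffun_consS ffunE.
by rewrite ffun_cons0.
Qed.
End FfunCons.

(** * Gelfand-Zetlin patterns as chains of interlacing rows *)

Section Chains.
Variables (R : idomainType) (b : R) (x : nat -> R) (n M : nat).
Notation Row := {ffun 'I_n -> 'I_M.+1}.

(** The top row is [al], and [g i] is row [i.+1], of length [k - i.+1]. *)
Definition chain_row k (al : nat -> nat) (g : {ffun 'I_k -> Row}) (i : nat) : nat -> nat :=
  if i is i'.+1 then (if insub i' is Some t then rowval (g t) else fun=> 0%N) else al.

Definition chain_ok k al (g : {ffun 'I_k -> Row}) :=
  [forall i : 'I_k, interlaced (k - i.+1) (chain_row al g i) (g i)].

Lemma chain_row_cons k al (mu : Row) (g : {ffun 'I_k -> Row}) (i : 'I_k) :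
  chain_row al (ffun_cons mu g) i.+1 = chain_row (rowval mu) g i.
Proof.
have -> : chain_row al (ffun_cons mu g) i.+1 =
    rowval (ffun_cons mu g (widen_ord (leqnSn k) i)).
  by rewrite /chain_row /= -[nat_of_ord i]/(val (widen_ord (leqnSn k) i)) valK.
case: i => -[|i] hi.
  by rewrite (_ : widen_ord _ _ = ord0) ?ffun_cons0 //; apply/val_inj.
have hi' := ltnW hi.
rewrite (_ : widen_ord _ _ = lift ord0 (Ordinal hi')) ?ffun_consS; last by apply/val_inj.
by rewrite /chain_row /= insubT.
Qed.

Lemma gz_sum_chains k al : gz_sum b x n M k al =
  \sum_(g : {ffun 'I_k -> Row} | chain_ok al g)
    \prod_(i < k) row_weight b (x (k - i.+1)%N) (k - i.+1) (chain_row al g i) (g i).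
Proof.
elim: k al => [|k IH] al.
  rewrite (big_pred1 [ffun=> [ffun=> ord0]]) ?big_ord0 // => g.
  transitivity true; first by apply/forallP => -[].
  by apply/esym/eqP/ffunP => -[].
rewrite [RHS]big_ffun_cons /= big_mkcond; apply: eq_bigr => mu _.
have ok (g : {ffun 'I_k -> Row}) : chain_ok al (ffun_cons mu g) = interlaced k al mu && chain_ok (rowval mu) g.
  apply/forallP/andP => [h|[h1 /forallP h2] i].
    split; first by have := h ord0; rewrite ffun_cons0 subSS subn0.
    by apply/forallP => i; have := h (lift ord0 i); rewrite ffun_consS lift0 subSS chain_row_cons.
  case: (unliftP ord0 i) => [j|] ->; first by rewrite ffun_consS lift0 subSS chain_row_cons; apply: h2.
  by rewrite ffun_cons0 subSS subn0.
rewrite (eq_bigl _ _ ok); case: (interlaced k al mu); last by rewrite big_pred0.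
rewrite IH big_distrr; apply: eq_bigr => g _ /=.
rewrite big_ord_recl ffun_cons0 subSS subn0; congr (_ * _).
by apply: eq_bigr => i _; rewrite ffun_consS lift0 subSS chain_row_cons.
Qed.
End Chains.

Section Arrays.
Variables (n M : nat) (lam : n.-tuple nat).
Notation Array := {ffun 'I_n * 'I_n -> 'I_M.+1}.
Notation Row := {ffun 'I_n -> 'I_M.+1}.
Let al j := nth 0%N lam (n.-1 - j).
Hypothesis alM : forall j, (al j <= M)%N.

Definition entA (A : Array) i j : nat := lookup 0%N (fun p => val (A p)) i j.

Lemma entAE (A : Array) (p : 'I_n * 'I_n) : entA A p.1 p.2 = A p.
Proof. exact: lookupE. Qed.

Definition array_ok (A : Array) :=
  [&& [forall p : 'I_n * 'I_n, (n <= p.1 + p.2)%N ==> (A p == ord0)],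
      [forall j : 'I_n, entA A 0 j == al j] &
      [forall p : 'I_n * 'I_n, (0 < p.1)%N && (p.1 + p.2 < n)%N ==>
         (entA A p.1.-1 p.2 <= A p <= entA A p.1.-1 p.2.+1)%N]].

Lemma array_okP (A : Array) : reflect
  [/\ forall p : 'I_n * 'I_n, (n <= p.1 + p.2)%N -> A p = ord0,
      forall j, (j < n)%N -> entA A 0 j = al j &
      forall i j, (0 < i)%N -> (i + j < n)%N -> (entA A i.-1 j <= entA A i j <= entA A i.-1 j.+1)%N]
  (array_ok A).
Proof.
apply: (iffP and3P) => -[h1 h2 h3]; split.
- by move=> p hp; have := forallP h1 p; rewrite hp => /eqP.
- by move=> j hj; apply/eqP; have := forallP h2 (Ordinal hj).
- move=> i j i0 hij; have hi : (i < n)%N by lia.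
  have hj : (j < n)%N by lia.
  have := forallP h3 (Ordinal hi, Ordinal hj); rewrite /= i0 hij /=.
  by rewrite -(entAE A (Ordinal hi, Ordinal hj)).
- by apply/forallP => p; apply/implyP => hp; rewrite h1.
- by apply/forallP => j; rewrite h2.
- apply/forallP => p; apply/implyP => /andP [p0 hp]; have := h3 _ _ p0 hp.
  by rewrite entAE.
Qed.

Definition array_of (g : {ffun 'I_n -> Row}) : Array :=
  [ffun p : 'I_n * 'I_n => inord (chain_row al g p.1 p.2)].

Definition rows_of (A : Array) : {ffun 'I_n -> Row} :=
  [ffun i : 'I_n => [ffun j : 'I_n => inord (entA A i.+1 j)]].

Lemma entA_le A i j : (entA A i j <= M)%N.
Proof.
rewrite /entA /lookup; case: insub => // u; case: insub => // w.
by rewrite -ltnS ltn_ord.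
Qed.

Lemma chain_row_le k (g : {ffun 'I_k -> Row}) i j : (chain_row al g i j <= M)%N.
Proof. by case: i => [|i] //=; case: insub => // t; apply: rowval_le. Qed.

Lemma entA_array_of g i j : (i < n)%N -> (j < n)%N -> entA (array_of g) i j = chain_row al g i j.
Proof.
move=> hi hj; rewrite (entAE _ (Ordinal hi, Ordinal hj)) ffunE inordK //=.
by rewrite ltnS chain_row_le.
Qed.

Lemma chain_rowS (g : {ffun 'I_n -> Row}) (i j : 'I_n) : chain_row al g i.+1 j = g i j.
Proof. by rewrite /= valK rowvalE. Qed.

(** A chain contains the empty row [n], which the array does not store. [rows_of] refills it with
    zeros, so the fixed-point condition restores what [chain_ok] demands of it. *)
Lemma array_of_ok g : array_ok (array_of g) && (rows_of (array_of g) == g) = chain_ok al g.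
Proof.
apply/andP/forallP => [[/array_okP [h1 h2 h3] /eqP h4] i|ok].
  apply/forallP => j; case: ltnP => hj.
    have hi : (i.+1 < n)%N by have := ltn_ord i; lia.
    have := h3 i.+1 j isT ltac:(lia); rewrite /= !entA_array_of ?chain_rowS //; lia.
  apply/eqP; have [hi|hi] := ltnP i.+1 n.
    have := h1 (Ordinal hi, j); rewrite /= => /(_ ltac:(lia)); rewrite ffunE.
    by rewrite chain_rowS inord_val.
  rewrite -h4 !ffunE /entA lookup_out ?ltnNge ?hi //.
  by apply/val_inj; rewrite /= inordK.
have ok' (i j : 'I_n) := forallP (ok i) j.
split.
  apply/array_okP; split.
  - move=> [[[|i] hi] j] /= h; first by have := ltn_ord j; lia.
    have := ok' (Ordinal (ltnW hi)) j; rewrite /= ltnNge (_ : (n - i.+1 <= j)%N); last by lia.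
    move=> /= /eqP e; rewrite ffunE /=; have /= -> := chain_rowS g (Ordinal (ltnW hi)) j.
    by rewrite inord_val.
  - by move=> j hj; rewrite entA_array_of //; apply: leq_ltn_trans hj.
  - move=> [//|i] j _ h; have hi : (i < n)%N by lia.
    have hj : (j < n)%N by lia.
    have := ok' (Ordinal hi) (Ordinal hj).
    rewrite [nat_of_ord (Ordinal hi)]/= [nat_of_ord (Ordinal hj)]/=.
    rewrite -(chain_rowS g (Ordinal hi) (Ordinal hj)) (_ : (j < n - i.+1)%N) //; last by lia.
    by rewrite !entA_array_of //=; lia.
apply/eqP/ffunP => i; apply/ffunP => j; rewrite !ffunE; apply/val_inj.
rewrite /= inordK ?ltnS ?entA_le //.
have [hi|hi] := ltnP i.+1 n; first by rewrite entA_array_of // chain_rowS.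
rewrite /entA lookup_out ?ltnNge ?hi //.
have := ok' i j; rewrite ltnNge (_ : (n - i.+1 <= j)%N); last by lia.
by move=> /= /eqP ->.
Qed.

Lemma rows_ofK A : array_ok A -> array_of (rows_of A) = A.
Proof.
move=> /array_okP [h1 h2 h3]; apply/ffunP => -[[[|i] hi] j]; rewrite ffunE; apply/val_inj.
  rewrite /= inordK ?ltnS // -h2 //.
  by rewrite (entAE _ (Ordinal hi, j)).
have /= -> := chain_rowS (rows_of A) (Ordinal (ltnW hi)) j.
rewrite inord_val !ffunE /= inordK ?ltnS ?entA_le //.
by rewrite (entAE _ (Ordinal hi, j)).
Qed.

Lemma gz_sum_arrays (R : idomainType) (b : R) (x : nat -> R) :
  gz_sum b x n M n al = \sum_(A | array_ok A)
    \prod_(i < n) (x (n - i.+1)%N ^+ (\sum_(j < n - i) entA A i j - \sum_(j < n - i.+1) entA A i.+1 j) *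
      \prod_(j < n - i.+1) (1 + b * x (n - i.+1)%N) ^+ (entA A i j < entA A i.+1 j)%N).
Proof.
rewrite gz_sum_chains [RHS](reindex_onto array_of rows_of) /=; last exact: rows_ofK.
rewrite (eq_bigl _ _ array_of_ok); apply: eq_bigr => g _; apply: eq_bigr => i _.
have hi := ltn_ord i; rewrite /row_weight.
have gE (j : nat) : (j < n - i.+1)%N -> rowval (g i) j = entA (array_of g) i.+1 j.
  by move=> hj; rewrite entA_array_of /= ?valK //; lia.
have pE (j : nat) : (j < n - i)%N -> chain_row al g i j = entA (array_of g) i j.
  by move=> hj; rewrite entA_array_of //; lia.
have sE : (n - i.+1).+1 = (n - i)%N by lia.
congr (_ ^+ (_ - _) * _).
- by rewrite sE; apply: eq_bigr => j _; rewrite pE.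
- by apply: eq_bigr => j _; rewrite gE.
- by apply: eq_bigr => j _; rewrite gE // pE //; have := ltn_ord j; lia.
Qed.

End Arrays.

Lemma propbP (Q : Prop) : reflect Q (propb Q).
Proof. by rewrite /propb; case: excluded_middle_informative => h; constructor. Qed.

Lemma nth_le_lmax (s : seq nat) j : (nth 0%N s j <= lmax s)%N.
Proof. by elim: s j => [|y s IH] [|j] //=; rewrite leq_max ?leqnn ?IH ?orbT. Qed.

(** Passes between products over rows [1] to [n] and over rows [0] to [n.-1], where the two boundary
    rows contribute 1. *)
Lemma prod_shift (R : comNzRingType) (f : nat -> R) n : f 0%N = 1 -> f n = 1 ->
  \prod_(i < n) f i.+1 = \prod_(i < n) f i.
Proof.
move=> f0 fn; have := big_ord_recl n (fun i : 'I_n.+1 => f i) (op := *%R) (idx := 1 : R).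
by rewrite big_ord_recr /= f0 fn mulr1 mul1r => ->.
Qed.

(** * Summation over the circles *)

Section CircleSums.
Variables (n : nat) (lam : n.-tuple nat).
Let M := lmax lam.
Notation Array := {ffun 'I_n * 'I_n -> 'I_M.+1}.
Notation Cells := {set 'I_n * 'I_n}.
Implicit Types (A : Array) (C : Cells) (P : patT n M) (p : 'I_n * 'I_n).

Definition circC C i j : bool := lookup false (fun p => p \in C) i j.

Lemma circCE C p : circC C p.1 p.2 = (p \in C).
Proof. exact: lookupE. Qed.

Definition forced_circle A p := (p.1 == 0%N :> nat) || (A p == entA A p.1.-1 p.2 :> nat).

Definition circ_ok A C := [forall p : 'I_n * 'I_n,
  if (p.1 + p.2 < n)%N then forced_circle A p ==> (p \in C) else p \notin C].

Definition mkpat (AC : Array * Cells) : patT n M :=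
  (AC.1, AC.2,
   [set p : 'I_n * 'I_n | (p.1 + p.2 < n)%N && edgeL (entA AC.1) (circC AC.2) p.1 p.2],
   [set p : 'I_n * 'I_n | (p.1 + p.2 < n)%N && edgeR (entA AC.1) (circC AC.2) p.1 p.2]).

Lemma mkpatK P : effpat P -> mkpat P.1.1 = P.
Proof.
move=> /propbP [enh eff]; have [/canonicalP [can _] _ EL ER] := enhanced_data enh eff.
case: P {enh eff} can EL ER => [[[A C] L] T] can EL ER; congr (_, _, _, _); apply/setP => p.
  rewrite inE; case: ltnP => [h|h] /=; last by have [_ _ /negbTE ->] := can p h.
  by rewrite -[RHS](lookupE false (fun p => p \in L)) -[LHS]EL.
rewrite inE; case: ltnP => [h|h] /=; last by have [_ _ _ /negbTE ->] := can p h.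
by rewrite -[RHS](lookupE false (fun p => p \in T)) -[LHS]ER.
Qed.

Lemma effpat_mkpat A C : effpat (mkpat (A, C)) = array_ok lam A && circ_ok A C.
Proof.
apply/propbP/andP => [[enh eff]|[/array_okP [h1 h2 h3] /forallP cok]].
  have [/canonicalP [can _] [g1 g2 g3 g4] _ _] := enhanced_data enh eff.
  split.
    apply/array_okP; split=> // p hp; have [h _ _ _] := can p hp.
    exact/val_inj.
  apply/forallP => p; case: ltnP => h; last by have [] := can p h.
  apply/implyP => /orP [/eqP p0|/eqP e]; rewrite -circCE.
    by rewrite p0; apply: g3.
  have [p0|p0] := posnP p.1; first by rewrite p0; apply: g3.
  by apply: g4 => //; apply: etrans (entAE A p) e.
have cokF i j : (i + j < n)%N -> (i == 0%N) || (entA A i j == entA A i.-1 j) -> circC C i j.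
  move=> h; have hi : (i < n)%N by lia.
  have hj : (j < n)%N by lia.
  have := cok (Ordinal hi, Ordinal hj); rewrite /= h /forced_circle /= -circCE.
  by rewrite -(entAE A (Ordinal hi, Ordinal hj)) /= => /implyP.
apply: data_enhanced.
- apply/canonicalP; split=> p hp.
    split; first by rewrite [pA _]/= h1.
    + by have := cok p; rewrite ltnNge hp.
    + by rewrite inE ltnNge hp.
    + by rewrite inE ltnNge hp.
  by rewrite !inE hp /edgeL /edgeR /= !andbF.
- split=> //.
  + by move=> j hj; apply: cokF.
  + by move=> i j i0 h e; apply: cokF => //; apply/orP; right; apply/eqP.
- move=> i j h; have hi : (i < n)%N by lia.
  have hj : (j < n)%N by lia.
  by rewrite /eL (lookupE _ _ (Ordinal hi, Ordinal hj)) inE /= h.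
- move=> i j h; have hi : (i < n)%N by lia.
  have hj : (j < n)%N by lia.
  by rewrite /eR (lookupE _ _ (Ordinal hi, Ordinal hj)) inE /= h.
Qed.

Lemma sum_effpat (V : nmodType) (F : patT n M -> V) :
  \sum_(P | effpat P) F P =
  \sum_(A | array_ok lam A) \sum_(C | circ_ok A C) F (mkpat (A, C)).
Proof.
rewrite (reindex_onto mkpat (fun P => P.1.1)) /=; last exact: mkpatK.
rewrite pair_big_dep; apply: eq_big => [[A C]|[A C] _] //=.
by rewrite eqxx andbT effpat_mkpat.
Qed.

(** Each cell that is not forced is independently encircled, with weight 1, or not, with weight
    [w p]. *)
Lemma sum_circles (R : comNzRingType) A (w : 'I_n * 'I_n -> R) :
  \sum_(C | circ_ok A C) \prod_(p : 'I_n * 'I_n | (p.1 + p.2 < n)%N && (p \notin C)) w p =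
  \prod_(p : 'I_n * 'I_n | (p.1 + p.2 < n)%N && ~~ forced_circle A p) (1 + w p).
Proof.
(* [f] weighs a cell inside [C] and [g] a cell outside it. A set violating [circ_ok] picks up a
   factor 0, so expanding the product over all sets gives the restricted sum. *)
pose f p : R := (p.1 + p.2 < n)%N%:R.
pose g p : R := if (p.1 + p.2 < n)%N then (if forced_circle A p then 0 else w p) else 1.
transitivity (\prod_p (f p + g p)); last first.
  rewrite [RHS]big_mkcond; apply: eq_bigr => p _; rewrite /f /g.
  by case: ltnP => _; case: (forced_circle A p); rewrite ?addr0 ?add0r.
rewrite bigA_distr big_mkcond; apply: eq_bigr => C _.
case: (boolP (circ_ok A C)) => [/forallP ok|].
  rewrite big_mkcond; apply: eq_bigr => p _; rewrite /f /g; have := ok p.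
  by case: ltnP => _; case: (p \in C); case: (forced_circle A p).
case/forallPn => p np; rewrite (bigD1 p) //= /f /g; move: np.
by case: ltnP => _; case: (p \in C); case: (forced_circle A p) => //=; rewrite mul0r.
Qed.

Definition row_sum A i := (\sum_(j < n - i) entA A i j)%N.

Lemma rowS_mkpat A C i : rowS (mkpat (A, C)) i = row_sum A i.
Proof.
rewrite /rowS /row_sum (big_ord_widen n (entA A i)) ?leq_subr //.
by apply: eq_bigl => j; rewrite validposE; lia.
Qed.

Lemma row_sumS_le A i : array_ok lam A -> (row_sum A i.+1 <= row_sum A i)%N.
Proof.
move=> /array_okP [_ _ h3]; have [hi|hi] := ltnP i n; last first.
  by rewrite /row_sum (_ : (n - i.+1 = 0)%N) ?big_ord0 //; lia.
rewrite /row_sum; have -> : (n - i = (n - i.+1).+1)%N by lia.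
rewrite [X in (_ <= X)%N]big_ord_recl; apply: leq_trans (leq_addl _ _).
apply: leq_sum => j _; have hj := ltn_ord j; rewrite lift0.
by have /andP [] := h3 i.+1 j isT ltac:(lia).
Qed.

Lemma rowD_out A C : circ_ok A C -> rowD (mkpat (A, C)) 0 = 0%N /\ rowD (mkpat (A, C)) n = 0%N.
Proof.
move=> /forallP ok; split; apply/eqP; rewrite cards_eq0; apply/eqP/setP => j; rewrite !inE validposE.
  case: (ltnP 0 n) => [n0|]; last by have := ltn_ord j; lia.
  have := ok (Ordinal n0, j); rewrite add0n ltn_ord /= /forced_circle /= -circCE /= => cc.
  by rewrite [circ _ _ _]cc.
by lia.
Qed.

(** Each cell without a circle contributes one [beta] through the rank and one variable through its
    row count; the rest depends on the row sums alone. *)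
Lemma xP_mkpat A C : array_ok lam A -> circ_ok A C ->
  xP (mkpat (A, C)) =
  \prod_(i < n) xnat n (n - i.+1)%N ^+ (row_sum A i - row_sum A i.+1) *
  \prod_(p : 'I_n * 'I_n | (p.1 + p.2 < n)%N && (p \notin C)) (beta n * xnat n (n - p.1)%N).
Proof.
move=> aok cok; have [D0 Dn] := rowD_out cok; rewrite /xP; set P := mkpat _ in D0 Dn *.
have -> : \prod_(k < n) 'X_k ^+ dexp P k =
    \prod_(i < n) xnat n (n - i.+1)%N ^+ (row_sum A i - row_sum A i.+1) *
    \prod_(i < n) xnat n (n - i.+1)%N ^+ rowD P i.+1.
  rewrite (reindex_inj rev_ord_inj) -big_split; apply: eq_bigr => i _ /=.
  rewrite -exprD -[X in _ = X ^+ _]/(xnat n (rev_ord i)) xnatE; congr (_ ^+ _).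
  rewrite /dexp !rowS_mkpat /= subKn //= addnC -addnBA ?row_sumS_le //.
  by rewrite addnC.
rewrite mulrCA; congr (_ * _); rewrite big_split /=; congr (_ * _).
  rewrite prodr_const; congr (_ ^+ _); apply: eq_card => p.
  by rewrite inE validposE.
(* At [i = 0] the base [xnat n n] is the default value 0, but its exponent [rowD P 0] vanishes. *)
rewrite (prod_shift (f := fun i => xnat n (n - i)%N ^+ rowD P i)) ?D0 ?Dn //.
transitivity (\prod_(i < n) \prod_(j < n | (i + j < n)%N && ((i, j) \notin C)) xnat n (n - i)%N);
  last by rewrite pair_big_dep; apply: eq_bigl => -[].
apply: eq_bigr => i _; rewrite prodr_const; congr (_ ^+ _); apply: eq_card => j.
by rewrite inE validposE [RHS]unfold_in /= -(circCE C (i, j)).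
Qed.

Lemma sum_xP : \sum_(P : patT n M | effpat P) xP P =
  gz_sum (beta n) (xnat n) n M n (fun j => nth 0%N lam (n.-1 - j)).
Proof.
rewrite sum_effpat gz_sum_arrays => [|j]; last exact: nth_le_lmax.
apply: eq_bigr => A aok.
rewrite (eq_bigr _ (fun C cok => xP_mkpat aok cok)) -big_distrr /= sum_circles.
rewrite [RHS]big_split /=; congr (_ * _).
(* The guard [0 < i] makes [h 0] equal to 1 and [h n] is an empty product, as the shift of rows
   requires. *)
pose h i : PR n := \prod_(j < n - i)
  (1 + beta n * xnat n (n - i)%N) ^+ ((0 < i)%N && (entA A i.-1 j < entA A i j)%N).
rewrite -[RHS]/(\prod_(i < n) h i.+1) prod_shift; last first.
- by rewrite /h subnn big_ord0.
- by rewrite /h big1.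
transitivity (\prod_(i < n) \prod_(j < n | (i + j < n)%N && ~~ forced_circle A (i, j))
    (1 + beta n * xnat n (n - i)%N)).
  by rewrite pair_big_dep; apply: eq_bigl => -[].
apply: eq_bigr => i _; rewrite /h.
rewrite (big_ord_widen n (fun j => (1 + beta n * xnat n (n - i)%N) ^+
   ((0 < i)%N && (entA A i.-1 j < entA A i j)%N))) ?leq_subr //.
rewrite big_mkcond [RHS]big_mkcond; apply: eq_bigr => j _.
have -> : (j < n - i)%N = (i + j < n)%N by lia.
case: ltnP => //= hij; rewrite /forced_circle /=.
have [//|i0] := posnP i; rewrite /=.
(* Below the top row a cell is not forced when it differs from its upper-left neighbour, which by
   interlacing means that it is strictly larger. *)
have /array_okP [_ _ h3] := aok; have := h3 i j i0 hij.
rewrite (entAE A (i, j)) => /andP [le _].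
by rewrite ltn_neqAle le andbT eq_sym; case: eqP.
Qed.
End CircleSums.

Theorem theorem4p2 (n : nat) (lam : n.-tuple nat)
  (Hpart : sorted geq lam) (s : seq nat) (Hs : reduced_word (w0 n) s) :
  lascoux_word s lam =
  \sum_(P : patT n (lmax lam) | effpat P) xP P.
Proof.
by rewrite sum_xP; apply: lascoux_gz_sum => // j; apply: nth_le_lmax.
Qed.
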